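(* Let $q$ be a prime power. Let $h \in \mathbb{F}_q[x,y] \setminus \{0\}$. Then the following are equivalent: (i) the polynomial $h$ has no absolutely irreducible factor defined over $\mathbb{F}_q$; (ii) there exist infinitely many positive integers $n$ such that $V(h)(\mathbb{F}_{q^n}) \subseteq \mathbb{A}^2(\mathbb{F}_q)$.
   Context: Let $p$ be the prime of which $q$ is a power, and fix an algebraic closure $\overline{\mathbb{F}_p}$ of $\mathbb{F}_p$; all finite fields of characteristic $p$ are regarded as subfields of it. For a subfield $L\subseteq\overline{\mathbb{F}_p}$, $\mathbb{A}^2(L)=L\times L$ and $V(h)(L)=\{(\alpha,\beta)\in\mathbb{A}^2(L)\mid h(\alpha,\beta)=0\}$. An absolutely irreducible factor of $h$ defined over $\mathbb{F}_q$ is a polynomial $g\in\mathbb{F}_q[x,y]$ dividing $h$ that is irreducible in $\overline{\mathbb{F}_p}[x,y]$. *)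

(* Defs.v *)
From HB Require Import structures.
From mathcomp Require Import all_boot all_algebra separable.
Set Implicit Arguments.
Unset Strict Implicit.
Unset Printing Implicit Defensive.
Import GRing.Theory.
Local Open Scope ring_scope.

(* A polynomial in F[x,y] is an element of {poly {poly F}}, where the outer
   'X plays the role of x and 'Y = 'X%:P that of y; accordingly, the
   evaluation u.[a, b] of polyXY substitutes x := a and y := b. *)

(* GF(m) as a subfield of K. By finite_subfield_uniq and finite_subfield_exists
   below, an algebraically closed K of characteristic p has exactly one such
   subfield L for m = p ^ k, 0 < k, so "the subfield F_m of K" can be
   introduced by a quantifier over L. *)
Definition finite_subfield (K : fieldType) (m : nat) (L : {pred K}) : Prop :=
  divring_closed L /\ exists s : seq K, [/\ uniq s, size s = m & L =i s].

Definition affine_plane (K : fieldType) (L : {pred K}) : {pred K * K} :=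
  [pred P | (P.1 \in L) && (P.2 \in L)].

Definition embed_XY (F K : fieldType) (iota : {rmorphism F -> K})
  (u : {poly {poly F}}) : {poly {poly K}} := map_poly (map_poly iota) u.

Definition zero_locus (F K : fieldType) (iota : {rmorphism F -> K})
    (h : {poly {poly F}}) (L : {pred K}) : {pred K * K} :=
  [pred P | (P \in affine_plane L) && ((embed_XY iota h).[P.1, P.2] == 0)].

Definition irreducible_elt (R : idomainType) (u : R) : Prop :=
  [/\ u != 0, u \isn't a GRing.unit &
      forall v w : R, u = v * w ->
        v \is a GRing.unit \/ w \is a GRing.unit].

(* Divisibility is spelled out because the relation %| of polydiv on
   {poly {poly F}} is divisibility up to a nonzero factor from {poly F}. *)
Definition abs_irreducible_factor (F K : fieldType)
    (iota : {rmorphism F -> K}) (g h : {poly {poly F}}) : Prop :=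
  irreducible_elt (embed_XY iota g) /\ exists u : {poly {poly F}}, h = g * u.

Lemma finite_subfield_expf (K : fieldType) m (L : {pred K}) x :
  finite_subfield m L -> x \in L -> x ^+ m = x.
Proof.
case=> -[L1 LB Ldiv] [s [s_uniq sz_s Ls]] Lx.
have L0 : 0 \in L by rewrite -(subrr 1) LB.
have s0 : 0 \in s by rewrite -Ls.
have [-> | nz_x] := eqVneq x 0.
  by rewrite expr0n -sz_s; case: (s) s0.
have LV y : y \in L -> y^-1 \in L by move=> Ly; rewrite -[_^-1]mul1r Ldiv.
have LM y z : y \in L -> z \in L -> y * z \in L.
  by move=> Ly Lz; rewrite -[z]invrK Ldiv ?LV.
pose t := rem 0 s.
have t_uniq : uniq t by rewrite rem_uniq.
have tE y : (y \in t) = (y != 0) && (y \in L).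
  by rewrite /t mem_rem_uniq // inE -Ls.
have t_perm : perm_eq [seq x * y | y <- t] t.
  apply: uniq_perm => //; first by rewrite map_inj_uniq //; apply: mulfI.
  move=> z; apply/mapP/idP => [[y] | ]; rewrite !tE.
    by case/andP=> nz_y Ly ->; rewrite mulf_neq0 ?LM.
  case/andP=> nz_z Lz; exists (x^-1 * z); last by rewrite mulVKf.
  by rewrite tE mulf_neq0 ?invr_eq0 //= LM ?LV.
have nz_prod : \prod_(y <- t) y != 0.
  by rewrite prodf_seq_neq0; apply/allP=> y; rewrite tE => /andP[].
have : \prod_(y <- [seq x * y | y <- t]) y = \prod_(y <- t) y by exact: perm_big.
rewrite big_map big_split /= big_const_seq count_predT iter_mulr_1.
rewrite -[RHS]mul1r => /(mulIf nz_prod) xt1.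
have -> : m = (size t).+1.
  by rewrite /t size_rem // prednK ?sz_s // -sz_s; case: (s) s0.
by rewrite exprS xt1 mulr1.
Qed.

Lemma finite_subfieldE (K : fieldType) m (L : {pred K}) :
  (1 < m)%N -> finite_subfield m L -> L =i [pred x | x ^+ m == x].
Proof.
move=> m_gt1 Lm x; rewrite inE; apply/idP/eqP.
  exact: finite_subfield_expf Lm.
move=> xm; apply: contraT => notLx.
have [s [s_uniq sz_s Ls]] := Lm.2.
have szP : size ('X^m - 'X : {poly K}) = m.+1.
  by rewrite size_polyDl size_polyXn // size_polyN size_polyX ltnS.
have nzP : 'X^m - 'X != 0 :> {poly K} by rewrite -size_poly_eq0 szP.
have := max_poly_roots (rs := x :: s) nzP.
rewrite szP /= sz_s ltnn => -> //; last by rewrite -Ls notLx.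
apply/andP; split; first by rewrite rootE !hornerE xm subrr.
apply/allP=> y; rewrite -Ls => Ly.
by rewrite rootE !hornerE (finite_subfield_expf Lm Ly) subrr.
Qed.

Lemma finite_subfield_uniq (K : fieldType) m (L1 L2 : {pred K}) :
  finite_subfield m L1 -> finite_subfield m L2 -> L1 =i L2.
Proof.
move=> Lm1 Lm2; have m_gt1 : (1 < m)%N.
  have [[L1_1 LB _] [s [s_uniq <- Ls]]] := Lm1.
  apply: (@uniq_leq_size _ [:: 0; 1] s); first by rewrite /= inE eq_sym oner_eq0.
  by move=> y; rewrite !inE -Ls => /orP[]/eqP-> //; rewrite -(subrr 1) LB.
by move=> x; rewrite (finite_subfieldE m_gt1 Lm1) (finite_subfieldE m_gt1 Lm2).
Qed.

Lemma finite_subfield_exists (K : closedFieldType) p k :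
    p \in [pchar K] -> (0 < k)%N ->
  finite_subfield (p ^ k) [pred x : K | x ^+ (p ^ k) == x].
Proof.
move=> charKp k_gt0; have p_pr := pcharf_prime charKp.
set m := (p ^ k)%N.
have m_gt1 : (1 < m)%N by rewrite -(expn0 p) ltn_exp2l ?prime_gt1.
have m_nat : [pchar K].-nat m.
  by rewrite (eq_pnat _ (pcharf_eq charKp)) pnatX pnat_id.
split; first split.
- by rewrite inE expr1n.
- move=> x y; rewrite !inE => /eqP xm /eqP ym.
  by rewrite exprDn_pchar // exprNn_pchar // xm ym.
- by move=> x y; rewrite !inE => /eqP xm /eqP ym; rewrite expr_div_n xm ym.
pose P : {poly K} := 'X^m - 'X.
have szP : size P = m.+1.
  by rewrite size_polyDl size_polyXn // size_polyN size_polyX ltnS.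
have sepP : separable_poly P.
  rewrite unlock derivB derivXn derivX -mulr_natr.
  have -> : m%:R = 0 :> {poly K}.
    by rewrite -polyC_natr /m natrX (pcharf0 charKp) expr0n eqn0Ngt k_gt0.
  by rewrite mulr0 sub0r -(scaleN1r 1) coprimepZr ?oppr_eq0 ?oner_eq0 ?coprimep1.
have [r Pr] := closed_field_poly_normal P.
have nz_lc : lead_coef P != 0 by rewrite lead_coef_eq0 -size_poly_eq0 szP.
exists r; split.
- rewrite -separable_prod_XsubC.
  by move: sepP; rewrite {1}Pr ?unlock derivZ coprimepZl ?coprimepZr.
- by apply: succn_inj; rewrite -(size_prod_XsubC r id) -szP Pr size_scale.
move=> x; rewrite inE -root_prod_XsubC -(rootZ x _ nz_lc) -Pr.
by rewrite rootE !hornerE subr_eq0.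
Qed.

(* Main.v *)
From HB Require Import structures.
Require Import Defs.
From Stdlib Require Import Classical_Prop.
From mathcomp Require Import all_boot all_algebra separable finfield zify ring.
Set Implicit Arguments.
Unset Strict Implicit.
Unset Printing Implicit Defensive.
Import GRing.Theory.
Local Open Scope ring_scope.

(** Throughout, the inner variable of K[x][y] is called x and the outer one y,
    so that u.[b, a] is the value of u at x = a, y = b, and Q stands for q ^ n.

    A polynomial without absolutely irreducible factor over GF(q) has few
    points.  Write h as a unit times a product of irreducible polynomials g of
    K[x, y].  No g is associated to its Frobenius conjugate, for otherwise a
    scalar multiple of g would have coefficients in GF(q) and divide h there
    [factor_not_self_conjugate].  So g and its conjugate have only finitely
    many common zeros [finite_common_zeros].  Take n = 1 modulo a common period
    of Frobenius on all the coefficients of the factors g and on all the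
    coordinates of these common zeros: then a point of g with coordinates in
    GF(q^n) is also on the conjugate of g, hence one of the common zeros, and
    both its coordinates are fixed by Frobenius^n and by Frobenius^(n-1),
    hence lie in GF(q).

    Conversely an absolutely irreducible g over GF(q) has, for all large n, a
    point over GF(q^n) with a coordinate outside GF(q)
    [irreducible_curve_points].  As g is not a p-th power, one of its partial
    derivatives is nonzero; exchange the variables to have dg/dy <> 0, then
    make g monic in y by the substitution that multiplies y by the leading
    coefficient.  The monic case [monic_curve_points] is a form of Stepanov's
    method in which, following Bombieri, p-th powers replace derivatives.

    Let f be monic in y of degree d, and suppose that f(a, y) has a root in
    GF(Q) only for those a in GF(Q) that belong to a fixed finite set.  For all
    the other a in GF(Q) with f(a, y) separable, and every root b of f(a, y),
    the conjugate B = b^Q is a root of f(a, y) different from b, hence a zero of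
    the divided difference (f(a, Y) - f(a, b)) / (Y - b), which has degree d - 1
    only.  Fix M = q^mu large and write Q = M q'.  Consider
      H = sum over i < I, j < d of g_ij(x, y) x^(i q') y^(j q')
    with g_ij of bounded degrees.  At such a point (a, b),
      H(a, b)^M = sum g_ij(a, b)^M a^i B^j,
    and the right-hand side vanishes identically modulo f and the divided
    difference as soon as the coefficients of the g_ij, raised to the power M,
    satisfy linear equations; because the powers of B can be reduced to d - 1
    of them instead of d, there are more unknowns than equations when I is
    close to M [auxiliary_coefficients].  Then the remainder of H modulo f
    vanishes on whole fibers over more values of a than its degree in x, so f
    divides H.

    That contradicts [Frobenius_independence]: on an irreducible curve, small
    polynomials g_i and q'-th powers of linearly independent e_i cannot satisfy
    sum g_i e_i^q' = 0 unless all g_i are 0.  To see this, expand along a branch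
    y = b(x) of the curve at a smooth point with local parameter t: the q'-th
    powers only involve powers of t^q', whereas the order of vanishing of a
    combination of the g_i is less than q' because of its small degree, so that
    the coefficients of the successive powers of t^q' have to vanish. *)

(** * Factorization over K(x) and Gauss's lemma *)

(** The size of one polynomial may occur at types that are only convertible;
    naming it turns its occurrences into a single variable for lia. *)
Ltac size_lia :=
  repeat match goal with
  | H : is_true (leq _ _) |- _ => revert H
  | H : @eq nat _ _ |- _ => revert H
  end;
  repeat match goal with
  | |- context [@size ?T ?s] => move: (@size T s) => ?
  end;
  intros; lia.

Section Gauss.
Variable K : closedFieldType.
Implicit Types (c r : {poly K}) (e f g k u v w : {poly {poly K}}).

Lemma scale_polyI (R : idomainType) (c : R) : c != 0 ->
  injective ( *:%R c : {poly R} -> {poly R}).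
Proof.
move=> c0 u v; rewrite -!mul_polyC; apply: mulfI.
by rewrite polyC_eq0.
Qed.

Lemma XsubC_divides u x :
  map_poly (horner_eval x) u = 0 -> exists v, u = ('X - x%:P) *: v.
Proof.
move=> ux0; exists (\poly_(i < size u) (u`_i %/ ('X - x%:P))).
apply/polyP=> i; rewrite coefZ coef_poly.
case: ltnP => [_|ui]; last by rewrite mulr0 nth_default.
rewrite mulrC divpK // dvdp_XsubCl; apply/rootP.
by have := congr1 (fun p : {poly K} => p`_i) ux0; rewrite coef_map coef0.
Qed.

(** Gauss's lemma.  As K is algebraically closed, it suffices to remove from c
    its linear factors one at a time: modulo X - x the product e w vanishes in
    the domain K[y], so X - x divides e or w. *)
Lemma Gauss_factor c f e w : c != 0 -> c *: f = e * w ->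
  exists c1 c2 e' w', [/\ e = c1 *: e', w = c2 *: w' & f = e' * w'].
Proof.
have [n] := ubnP (size c); elim: n => // n IHn in c e w * => szc c0 fE.
have [/size_poly1P[a a0 ca] | /closed_rootP[x cx]] := boolP (size c == 1%N).
  exists a%:P, 1, (a^-1%:P *: e), w; split; last 1 first.
  - by rewrite -scalerAl -fE ca scalerA -polyCM mulVf ?scale1r.
  - by rewrite scalerA -polyCM mulfV // scale1r.
  - by rewrite scale1r.
have /factor_theorem[c' cE] := cx.
have c'0 : c' != 0 by apply: contraNneq c0 => c'0; rewrite cE c'0 mul0r.
have szc' : (size c' < n)%N.
  by move: szc; rewrite cE size_Mmonic ?monicXsubC // size_XsubC addn2 ltnS.
have Xx0 : 'X - x%:P != 0 :> {poly K} by rewrite polyXsubC_eq0.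
have : map_poly (horner_eval x) (e * w) = 0.
  by rewrite -fE map_polyZ /= /horner_eval (rootP cx) scale0r.
rewrite rmorphM => /eqP; rewrite mulf_eq0 => /orP[]/eqP/XsubC_divides[v vE].
  have [||c1 [c2 [e' [w' [vE' -> ->]]]]] := IHn c' v w szc' => //.
    apply: (scale_polyI Xx0).
    by rewrite scalerA mulrC -cE fE vE scalerAl.
  by exists (('X - x%:P) * c1), c2, e', w'; rewrite vE vE' scalerA.
have [||c1 [c2 [e' [w' [-> vE' ->]]]]] := IHn c' e v szc' => //.
  apply: (scale_polyI Xx0).
  by rewrite scalerA mulrC -cE fE vE scalerAr.
by exists c1, (('X - x%:P) * c2), e', w'; rewrite vE vE' scalerA.
Qed.

Lemma unit_poly2P u :
  reflect (exists2 a : K, a != 0 & u = a%:P%:P) (u \is a GRing.unit).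
Proof.
apply: (iffP idP) => [|[a a0 ->]]; last by rewrite !rmorph_unit ?unitfE.
rewrite poly_unitE => /andP[/size_poly1P[c _ ->]].
rewrite coefC /= poly_unitE => /andP[/size_poly1P[a a0 ->] _].
by exists a.
Qed.

(** Irreducibility over the function field K(x), written without
    fractions. *)
Definition generically_irreducible f := forall c e w,
  c != 0 -> c *: f = e * w -> (size e <= 1)%N \/ (size w <= 1)%N.

Lemma irreducible_generically f :
  irreducible_elt f -> generically_irreducible f.
Proof.
case=> f0 _ irr_f c e w c0 /(Gauss_factor c0)[c1 [c2 [e' [w' [-> -> fE]]]]].
have unit_size v : v \is a GRing.unit -> (size v <= 1)%N.
  by case/unit_poly2P=> a _ ->; apply: size_polyC_leq1.
by case: (irr_f _ _ fE) => /unit_size sz1; [left | right];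
   apply: leq_trans (size_scale_leq _ _) sz1.
Qed.

(** Divisibility by g over K(x) implies divisibility over K[x], because an
    irreducible g involving y has no nonconstant factor in K[x]. *)
Lemma irreducible_dvd_num g c k w : irreducible_elt g -> (1 < size g)%N ->
  c != 0 -> c *: k = g * w -> exists w', k = g * w'.
Proof.
move=> [g0 _ irr_g] sz_g c0.
case/(Gauss_factor c0)=> c1 [c2 [e' [w' [gE _ ->]]]].
have := irr_g c1%:P e'; rewrite mul_polyC => /(_ gE)[].
  case/unit_poly2P=> a a0 /polyC_inj c1E; exists (a^-1%:P *: w').
  by rewrite gE c1E -!scalerAl -scalerAr scalerA -polyCM mulfV // scale1r.
case/unit_poly2P=> a _ e'E; move: sz_g; rewrite gE e'E ltnNge.
by rewrite (leq_trans (size_scale_leq _ _)) // size_polyC_leq1.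
Qed.

Lemma dvdp_num e f : e %| f -> exists c w, c != 0 /\ c *: f = e * w.
Proof.
move/Pdiv.Idomain.dvdpP=> [[c w] /= c0 E]; exists c, w.
by rewrite E mulrC.
Qed.

Lemma generically_irreducible_coprime f v : generically_irreducible f ->
  v != 0 -> (size v < size f)%N -> resultant f v != 0.
Proof.
move=> irr_f v0 ltvf; rewrite resultant_eq0; apply/negP=> sz_e.
have [c [w [c0 fE]]] := dvdp_num (dvdp_gcdl f v).
have sz_ev : (size (gcdp f v) <= size v)%N by apply: leq_gcdpr.
case: (irr_f _ _ _ c0 fE) => [|sz_w]; first by rewrite leqNgt sz_e.
have /eqP : size (c *: f) = size f by rewrite size_scale.
rewrite fE => /eqP szE.
by have := size_polyMleq (gcdp f v) w; rewrite szE; size_lia.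
Qed.

(** The resultant eliminates y; when it vanishes, the common factor over K(x)
    is g up to an element of K(x), and Gauss's lemma makes g divide k. *)
Lemma common_zeros_eliminant g k : irreducible_elt g -> k != 0 ->
    (1 < size g)%N -> ~ (exists w, k = g * w) ->
  exists2 r, r != 0 & exists u v, r%:P = u * g + v * k.
Proof.
move=> irr_g k0 sz_g ndvd.
have [sz_k | sz_k] := leqP (size k) 1.
  exists k`_0; last by exists 0, 1; rewrite mul0r add0r mul1r -size1_polyC.
  by move: k0; rewrite {1}(size1_polyC sz_k) polyC_eq0.
exists (resultant g k); last first.
  by have [[u v] /= _ E] := resultant_in_ideal sz_g sz_k; exists u, v.
rewrite resultant_eq0; apply/negP=> sz_e; apply: ndvd.
have [c [w [c0 gE]]] := dvdp_num (dvdp_gcdl g k).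
have [sz_e1 | sz_w] := irreducible_generically irr_g c0 gE.
  by rewrite leqNgt sz_e in sz_e1.
have [c' [w' [c'0 kE]]] := dvdp_num (dvdp_gcdr g k).
have w_nz : w`_0 != 0.
  apply: contraTneq sz_g => w00.
  have w0 : w = 0 by rewrite (size1_polyC sz_w) w00.
  have /eqP : c *: g = 0 by rewrite gE w0 mulr0.
  by rewrite scale_poly_eq0 (negPf c0) /= => /eqP->; rewrite size_poly0.
apply: (irreducible_dvd_num (c := w`_0 * c') (w := c *: w') irr_g sz_g).
  by rewrite mulf_neq0.
rewrite -scalerA kE -scalerAr [RHS]scalerAl gE -mul_polyC -size1_polyC //.
by rewrite mulrCA mulrA.
Qed.
End Gauss.

(** * Common zeros and degrees in the inner variable *)

Section Common.
Variable K : closedFieldType.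
Implicit Types (c r : {poly K}) (e f g k u v w : {poly {poly K}}).

Lemma horner_fiber u (a b : K) :
  u.[a, b] = (map_poly (horner_eval b) u).[a].
Proof. by rewrite -[a in RHS](hornerC a b) -horner_evalE horner_map. Qed.

Lemma horner_subst u (r : {poly K}) (a : K) : u.[r].[a] = u.[r.[a], a].
Proof. by rewrite horner_fiber -[LHS]/(horner_eval a u.[r]) -horner_map. Qed.

Lemma roots_listed (p : {poly K}) : p != 0 ->
  exists s : seq K, forall x, root p x = (x \in s).
Proof.
move=> p0; have [s pE] := closed_field_poly_normal p; exists s => x.
by rewrite pE rootZ ?lead_coef_eq0 // root_prod_XsubC.
Qed.

(** The eliminant leaves finitely many values of x.  On each line x = b, one of
    g and k does not vanish identically, as otherwise X - b would be a common
    factor, hence g itself up to a constant, and g would divide k. *)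
Lemma finite_common_zeros g k :
    irreducible_elt g -> ~ (exists w, k = g * w) ->
  exists Z : seq (K * K), forall a b,
    g.[a, b] = 0 -> k.[a, b] = 0 -> (a, b) \in Z.
Proof.
move=> irr_g ndvd; have [g0 _ g_fact] := irr_g.
have k0 : k != 0 by apply/eqP=> k0; apply: ndvd; exists 0; rewrite mulr0.
have [r r0 rP] : exists2 r, r != 0 &
    forall a b, g.[a, b] = 0 -> k.[a, b] = 0 -> root r b.
  have [sz_g | sz_g] := leqP (size g) 1.
    exists g`_0; first by move: g0; rewrite {1}(size1_polyC sz_g) polyC_eq0.
    by move=> a b; rewrite {1}(size1_polyC sz_g) hornerC => /rootP.
  have [r r0 [u [v rE]]] := common_zeros_eliminant irr_g k0 sz_g ndvd.
  exists r => // a b gab kab; apply/rootP.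
  by rewrite -(hornerC r a%:P) rE !hornerE gab kab !mulr0 addr0.
have [s sP] := roots_listed r0.
pose ev b u := map_poly (horner_eval b) u.
have fib b : exists t : seq K, forall a, g.[a, b] = 0 -> k.[a, b] = 0 -> a \in t.
  have [gb0 | gb0] := eqVneq (ev b g) 0; last first.
    have [t tP] := roots_listed gb0; exists t => a + _.
    by rewrite -tP horner_fiber => /rootP.
  have [kb0 | kb0] := eqVneq (ev b k) 0; last first.
    have [t tP] := roots_listed kb0; exists t => a _.
    by rewrite -tP horner_fiber => /rootP.
  have [g' gE] := XsubC_divides gb0; have [k' kE] := XsubC_divides kb0.
  have := g_fact ('X - b%:P)%:P g'; rewrite mul_polyC => /(_ gE)[].
    case/unit_poly2P=> a _ /polyC_inj Xb.
    by have := size_polyC_leq1 a; rewrite -Xb size_XsubC.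
  move=> Ug'; case: ndvd; exists (g'^-1 * k').
  by rewrite gE kE -scalerAl mulrA mulrV // mul1r.
have [Z ZP] : exists Z : seq (K * K), forall a b, b \in s ->
    g.[a, b] = 0 -> k.[a, b] = 0 -> (a, b) \in Z.
  elim: (s) => [|b0 s' [Z ZP]]; first by exists [::].
  have [t tP] := fib b0; exists ([seq (a, b0) | a <- t] ++ Z) => a b.
  rewrite inE mem_cat => /orP[/eqP-> gab kab | bs gab kab].
    by rewrite map_f // tP.
  by rewrite ZP ?orbT.
by exists Z => a b gab kab; apply: ZP => //; rewrite -sP (rP a).
Qed.
End Common.

Section Degree.
Variable K : closedFieldType.
Implicit Types (c r : {poly K}) (e f g k u v w : {poly {poly K}}).

Definition xdeg_le (m : nat) u := forall i, (size (u`_i)%R <= m.+1)%N.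

Lemma xdeg_leW m n u : (m <= n)%N -> xdeg_le m u -> xdeg_le n u.
Proof. by move=> mn um i; apply: leq_trans (um i) _. Qed.

Lemma xdeg_le_exists u : exists m, xdeg_le m u.
Proof.
exists (sizeY u) => i; exact: leq_trans (max_size_coefXY _ _) (leqnSn _).
Qed.

Lemma xdeg_le0 m : xdeg_le m 0.
Proof. by move=> i; rewrite coef0 size_poly0. Qed.

Lemma xdeg_leD m u v : xdeg_le m u -> xdeg_le m v -> xdeg_le m (u + v).
Proof.
move=> um vm i; rewrite coefD (leq_trans (size_polyD _ _)) // geq_max.
by rewrite um vm.
Qed.

Lemma xdeg_leN m u : xdeg_le m u -> xdeg_le m (- u).
Proof. by move=> um i; rewrite coefN size_polyN. Qed.

Lemma xdeg_le_sum m (I : Type) (s : seq I) (P : pred I)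
    (G : I -> {poly {poly K}}) :
  (forall i, P i -> xdeg_le m (G i)) -> xdeg_le m (\sum_(i <- s | P i) G i).
Proof.
move=> Gm; elim/big_ind: _ => // [|u v]; [exact: xdeg_le0 | exact: xdeg_leD].
Qed.

Lemma size_mulS m n (p q : {poly K}) :
  (size p <= m.+1)%N -> (size q <= n.+1)%N -> (size (p * q)%R <= (m + n).+1)%N.
Proof.
move=> pm qn; apply: leq_trans (size_polyMleq _ _) _.
by size_lia.
Qed.

Lemma xdeg_leM m n u v :
  xdeg_le m u -> xdeg_le n v -> xdeg_le (m + n) (u * v).
Proof.
move=> um vn i; rewrite coefM (leq_trans (size_sum _ _ _)) //.
by apply/bigmax_leqP=> j _; apply: size_mulS.
Qed.

Lemma xdeg_leC m c : (size c <= m.+1)%N -> xdeg_le m c%:P.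
Proof. by move=> cm i; rewrite coefC; case: eqP; rewrite ?size_poly0. Qed.

Lemma xdeg_leZ m n c u :
  (size c <= m.+1)%N -> xdeg_le n u -> xdeg_le (m + n) (c *: u).
Proof. by move=> cm um; rewrite -mul_polyC; apply/xdeg_leM/um/xdeg_leC. Qed.

Lemma xdeg_le_scale m (a : K) u : xdeg_le m u -> xdeg_le m (a%:P *: u).
Proof. by apply: (@xdeg_leZ 0%N m); apply: size_polyC_leq1. Qed.

Lemma xdeg_leXn m n : xdeg_le m 'X^n.
Proof.
by move=> i; rewrite coefXn; case: eqP; rewrite ?size_poly0 ?size_poly1.
Qed.

(** Each step of the division by the monic f lowers the degree in y by one and
    raises the degree in x by at most D. *)
Lemma xdeg_le_rmodp f D m n u : f \is monic -> xdeg_le D f ->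
  xdeg_le m u -> (size u <= n)%N -> xdeg_le (m + D * n) (Pdiv.Ring.rmodp u f).
Proof.
move=> fm fD; elim: n m u => [|n IHn] m u um szu.
  move: szu; rewrite size_poly_leq0 => /eqP->.
  by rewrite Pdiv.Ring.rmod0p; apply: xdeg_le0.
have [lt_uf | le_fu] := ltnP (size u) (size f).
  by rewrite Pdiv.Ring.rmodp_small //; apply: xdeg_leW um; rewrite leq_addr.
have f_gt0 : (0 < size f)%N by rewrite size_poly_gt0 monic_neq0.
have [szu' | szu'] := leqP (size u) n.
  by apply: xdeg_leW (IHn _ _ um szu'); rewrite leq_add2l leq_mul.
have szuE : size u = n.+1 by apply/eqP; rewrite eqn_leq szu.
pose q := u`_n *: 'X^(n.+1 - size f).
have -> : Pdiv.Ring.rmodp u f = Pdiv.Ring.rmodp (u - q * f) f.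
  by rewrite Pdiv.RingMonic.rmodpB // Pdiv.RingMonic.rmodp_mull // subr0.
have -> : (m + D * n.+1 = (m + D) + D * n)%N by lia.
apply: IHn.
  apply: xdeg_leD; first by apply: xdeg_leW um; rewrite leq_addr.
  apply/xdeg_leN/xdeg_leM => //.
  by rewrite -[m]addn0; apply/xdeg_leZ/xdeg_leXn.
apply/leq_sizeP=> j; rewrite leq_eqVlt => /orP[/eqP<-|ltnj].
  rewrite coefB -scalerAl mulrC coefZ coefMXn ltnNge.
  have -> : (n.+1 - size f <= n)%N by lia.
  have -> : (n - (n.+1 - size f) = (size f).-1)%N.
    by move: f_gt0 le_fu; rewrite szuE; lia.
  by rewrite -/(lead_coef f) (monicP fm) mulr1 subrr.
rewrite nth_default // (leq_trans _ ltnj) //.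
apply: leq_trans (size_polyD _ _) _; rewrite geq_max szuE leqnn /= size_polyN.
apply: leq_trans (size_polyMleq _ _) _.
have := size_scale_leq u`_n ('X^(n.+1 - size f) : {poly {poly K}}).
rewrite -/q size_polyXn => qs.
by move: (size q) (size f) (size u) qs f_gt0 le_fu szuE => a b c; lia.
Qed.

Lemma size_det_le n m (A : 'M[{poly K}]_n) :
  (forall i j, (size (A i j) <= m.+1)%N) -> (size (\det A)%R <= (n * m).+1)%N.
Proof.
move=> Am; apply: leq_trans (size_sum _ _ _) _; apply/bigmax_leqP=> s _.
rewrite -signr_odd mulr_sign.
have -> : forall b (x : {poly K}), size (if b then - x else x) = size x.
  by case=> x //; rewrite size_polyN.
have : forall (g : 'I_n -> 'I_n) (t : seq 'I_n),
    (size (\prod_(i <- t) A i (g i))%R <= (size t * m).+1)%N.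
  move=> g; elim=> [|i t IHt]; first by rewrite big_nil size_poly1.
  by rewrite big_cons /= mulSn; apply: size_mulS.
move=> /(_ _ (index_enum _)) prod_le; apply: leq_trans (prod_le _) _.
by rewrite -[index_enum _]enumT size_enum_ord.
Qed.

(** Over K(x), v is invertible modulo f; the resultant gives a common
    denominator whose degree is controlled by that of f and v. *)
Lemma bounded_eliminant f v m : generically_irreducible f ->
    v != 0 -> (size v < size f)%N -> xdeg_le m f -> xdeg_le m v ->
  exists s : {poly K}, [/\ s != 0, (size s <= (2 * size f * m).+1)%N
    & exists u w, s%:P = u * f + w * v].
Proof.
move=> irr_f v0 ltvf fm vm.
have [szv | szv] := leqP (size v) 1.
  exists v`_0; split; first by rewrite -polyC_eq0 -(size1_polyC szv).
    apply: leq_trans (vm 0) _; rewrite ltnS -{1}[m]mul1n leq_mul2r.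
    by apply/orP; right; size_lia.
  by exists 0, 1; rewrite mul0r add0r mul1r -size1_polyC.
exists (resultant f v); split; first exact: generically_irreducible_coprime.
  pose n := ((size v).-1 + (size f).-1)%N.
  apply: leq_trans (size_det_le (m := m) _) _; last first.
    rewrite ltnS leq_mul2r; apply/orP; right.
  size_lia.
  move=> i j; rewrite Sylvester_mxE.
  by case: (split i) => k; case: (k <= j)%N; rewrite ?mulr1n ?mulr0n ?size_poly0.
have [|//|[u w] /= _ E] := @resultant_in_ideal _ f v; last by exists u, w.
exact: leq_trans szv (ltnW ltvf).
Qed.
End Degree.

(** * Power maps, linear systems and branches of a plane curve *)

Section PowerMap.
Variables (R : comNzRingType) (m : nat) (char_m : [pchar R].-nat m).

(** The proof that m is a power of the characteristic is an argument so that
    ring morphism instances can be attached to the map. *)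
Definition power_map of [pchar R].-nat m := fun x : R => x ^+ m.

Let pow := power_map char_m.

Fact power_map_is_zmod_morphism : zmod_morphism pow.
Proof. by move=> x y; rewrite /pow /power_map exprDn_pchar // exprNn_pchar. Qed.
HB.instance Definition _ :=
  GRing.isZmodMorphism.Build R R pow power_map_is_zmod_morphism.

Fact power_map_is_monoid_morphism : monoid_morphism pow.
Proof. by split=> [|x y]; rewrite /pow /power_map ?expr1n ?exprMn. Qed.
HB.instance Definition _ :=
  GRing.isMonoidMorphism.Build R R pow power_map_is_monoid_morphism.
End PowerMap.

Lemma pnat_pchar_poly (R : nzRingType) m :
  [pchar R].-nat m -> [pchar {poly R}].-nat m.
Proof. by rewrite (eq_pnat _ (pchar_poly R)). Qed.

Lemma power_map_sum (R : comNzRingType) m (char_m : [pchar R].-nat m)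
  (I : Type) (s : seq I) (P : pred I) (G : I -> R) :
  (\sum_(i <- s | P i) G i) ^+ m = \sum_(i <- s | P i) G i ^+ m.
Proof. exact: (rmorph_sum (power_map char_m)). Qed.

Lemma closed_rootn (K : closedFieldType) n (c : K) :
  (0 < n)%N -> exists x, x ^+ n = c.
Proof.
move=> n_gt0; have /closed_rootP[x] : size ('X^n - c%:P : {poly K}) != 1%N.
  by rewrite size_XnsubC // eqSS -lt0n.
by rewrite rootE !hornerE subr_eq0 => /eqP<-; exists x.
Qed.

Section PthPower.
Variables (p : nat).

Lemma pchar_mulrn_eq0 (R : nzRingType) (x : R) k :
  p \in [pchar R] -> ~~ (p %| k)%N -> x *+ k = 0 -> x = 0.
Proof.
move=> charRp p_k xk0; have p_pr := pcharf_prime charRp.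
have : coprime p k by rewrite prime_coprime.
case: k p_k xk0 => [|k] p_k xk0; first by rewrite dvdn0 in p_k.
case/(coprimeP _ (prime_gt0 p_pr)) => [[u v] /= E].
have xp0 : x *+ p = 0 by rewrite -mulr_natr pcharf0 ?mulr0.
have := congr1 (fun n => x *+ n) E; rewrite /= mulrnBr; last by lia.
by rewrite mulnC mulrnA xp0 mul0rn mulnC mulrnA xk0 mul0rn subr0 mulr1n.
Qed.

(** Only exponents divisible by p survive, and x |-> x ^+ p is additive. *)
Lemma deriv0_pth_power (R : comNzRingType) (u : {poly R}) :
    p \in [pchar R] -> u^`() = 0 ->
    (forall i, exists x, u`_i = x ^+ p) ->
  exists v, u = v ^+ p.
Proof.
move=> charRp du0 coef_pow; have p_pr := pcharf_prime charRp.
have p_gt0 := prime_gt0 p_pr.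
have [r rP] := @fin_all_exists _ _ _ (fun i : 'I_(size u) => coef_pow (i * p)%N).
have char_p : [pchar {poly R}].-nat p.
  by apply: pnat_pchar_poly; rewrite (eq_pnat _ (pcharf_eq charRp)) pnat_id.
exists (\sum_(i < size u) r i *: 'X^i).
rewrite power_map_sum //; apply/polyP=> k.
rewrite coef_sum.
under eq_bigr => i _ do rewrite exprZn -rP -exprM coefZ coefXn.
have [p_k | p_k] := boolP (p %| k)%N; last first.
  rewrite big1 => [|i _]; last first.
    case: eqP => [kE|_]; last by rewrite mulr0.
    by rewrite kE dvdn_mull in p_k.
  case: k p_k => [|k] p_k; first by rewrite dvdn0 in p_k.
  by apply: (pchar_mulrn_eq0 charRp p_k); rewrite -coef_deriv du0 coef0.
have kE := divnK p_k.
have [lt_k | le_k] := ltnP (k %/ p) (size u).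
  rewrite (bigD1 (Ordinal lt_k)) //= kE eqxx mulr1 big1 ?addr0 // => i neq_i.
  case: eqP => [kE'|_]; last by rewrite mulr0.
  case/eqP: neq_i.
  by apply/val_inj; rewrite /= kE' mulnK.
rewrite big1 ?nth_default // => [|i _].
  by apply: leq_trans le_k _; apply: leq_div.
case: eqP => [kE'|_]; last by rewrite mulr0.
by move: (ltn_ord i) le_k; rewrite kE' mulnK // ltnNge => /negPf->.
Qed.

Lemma deriv0_pth_power2 (K : closedFieldType) (u : {poly {poly K}}) :
    p \in [pchar K] -> u^`() = 0 -> (swapXY u)^`() = 0 ->
  exists v, u = v ^+ p.
Proof.
move=> charKp du0 du0'; have p_gt0 := prime_gt0 (pcharf_prime charKp).
apply: deriv0_pth_power => // [|i]; first by rewrite pchar_poly.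
apply: deriv0_pth_power => // [|j].
  apply/polyP=> j; have := congr1 (fun w : {poly {poly K}} => w`_j`_i) du0'.
  by rewrite !coef_deriv coefMn coef_swapXY !coef0.
by have [x <-] := closed_rootn u`_i`_j p_gt0; exists x.
Qed.
End PthPower.

Lemma underdetermined_solvable (K : fieldType) (I J : finType) (A : I -> J -> K) :
    (#|J| < #|I|)%N ->
  exists c : I -> K, (exists i, c i != 0) /\ forall j, \sum_i c i * A i j = 0.
Proof.
move=> ltJI; pose B := \matrix_(i < #|I|, j < #|J|) A (enum_val i) (enum_val j).
have : kermx B != 0.
  rewrite -mxrank_eq0 mxrank_ker -lt0n subn_gt0.
  exact: leq_ltn_trans (rank_leq_col B) ltJI.
case/rowV0Pn=> v /sub_kermxP vB0 /rV0Pn[i0 vi0].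
exists (fun i => v 0 (enum_rank i)); split.
  by exists (enum_val i0); rewrite enum_valK.
move=> j; have := congr1 (fun w : 'rV_#|J| => w 0 (enum_rank j)) vB0.
rewrite !mxE => sum0; rewrite -[RHS]sum0.
rewrite (reindex _ (onW_bij _ (@enum_val_bij I))) /=.
by apply: eq_bigr => i _; rewrite enum_valK mxE enum_rankK.
Qed.

Section Branch.
Variable K : closedFieldType.
Implicit Types (c r : {poly K}) (e f g u v w : {poly {poly K}}).

(** Newton's iteration: a polynomial approximation b(x) of the branch of f = 0
    through a point where df/dy is nonzero.  A polynomial to a prescribed
    precision avoids power series. *)
Lemma Hensel_branch f (a0 b0 : K) N :
    f.[b0, a0] = 0 -> f^`().[b0, a0] != 0 ->
  exists b : {poly K}, ('X - a0%:P) ^+ N %| f.[b].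
Proof.
move=> f0 df0; suff [b [_ ?]] : exists b : {poly K},
    b.[a0] = b0 /\ ('X - a0%:P) ^+ N.+1 %| f.[b].
  by exists b; apply: dvdp_trans (dvdp_exp2l _ (leqnSn N)) _.
have eval_b u b : b.[a0] = b0 -> u.[b].[a0] = u.[b0, a0].
  by move=> <-; apply: horner_subst.
elim: N => [|N [b [ba0 /dvdpP[g fb]]]].
  exists b0%:P; rewrite hornerC; split=> //.
  by rewrite expr1 dvdp_XsubCl; apply/rootP.
pose t := 'X - a0%:P; pose e := - (g.[a0] / f^`().[b0, a0]).
pose h := e *: t ^+ N.+1; exists (b + h); split.
  by rewrite hornerD hornerZ horner_exp hornerXsubC subrr exprS mul0r mulr0 addr0.
have [z ->] : exists z, f.[b + h] = f.[b] + f^`().[b] * h + h ^+ 2 * z.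
  elim/poly_ind: (f) => [|u c [z IHu]].
    by exists 0; rewrite deriv0 !horner0 mul0r mulr0 !addr0.
  exists (z * (b + h) + u^`().[b]).
  rewrite derivD derivC addr0 derivM derivX mulr1 !hornerE IHu; ring.
have -> : f.[b] + f^`().[b] * h + h ^+ 2 * z =
   (g + e%:P * f^`().[b]) * t ^+ N.+1 + t ^+ N.+2 * (t ^+ N * (e ^+ 2)%:P * z).
  rewrite fb /h -/t -!mul_polyC rmorphXn /= !exprS; ring.
apply: dvdp_add; last by apply: dvdp_mulr.
rewrite [t ^+ N.+2]exprS; apply: dvdp_mul => //.
rewrite dvdp_XsubCl; apply/rootP.
by rewrite !hornerE eval_b // mulNr divfK // subrr.
Qed.

Variable a : K.
Let t := 'X - a%:P.

(** The coefficients of p as a polynomial in the local parameter X - a. *)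
Definition taylor_coef (p : {poly K}) k := (p \Po ('X + a%:P))`_k.

Lemma taylor_sum n (p : {poly K}) : (size p <= n)%N ->
  p = \sum_(k < n) taylor_coef p k *: t ^+ k.
Proof.
move=> szp; rewrite -[p in LHS]comp_polyXr.
have -> : 'X = ('X + a%:P) \Po t by rewrite comp_polyD comp_polyX comp_polyC subrK.
rewrite comp_polyA comp_polyE.
have sz_le : (size (p \Po ('X + a%:P)) <= n)%N.
  by rewrite size_comp_poly2 // size_XaddC.
by rewrite (big_ord_widen n (fun k => taylor_coef p k *: t ^+ k)) // big_mkcond
   /=; apply: eq_bigr => k _; case: ltnP => // ?;
   rewrite /taylor_coef nth_default ?scale0r.
Qed.

Lemma taylor_dvd n (p : {poly K}) : (forall k, (k < n)%N -> taylor_coef p k = 0) ->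
  t ^+ n %| p.
Proof.
move=> low0; have [lt_pn | le_np] := ltnP (size p) n.
  rewrite (taylor_sum (ltnW lt_pn)) big1 ?dvdp0 // => k _.
  by rewrite low0 ?scale0r.
rewrite (taylor_sum (leqnn (size p))).
elim/big_ind: _ => [|x y|k _]; [exact: dvdp0 | exact: dvdp_add |].
have [lt_kn | le_nk] := ltnP k n; first by rewrite low0 // scale0r dvdp0.
by rewrite -mul_polyC; apply/dvdp_mull/dvdp_exp2l.
Qed.

End Branch.

(** * Linear independence under Frobenius *)

Section Nonvanishing.
Variables (K : closedFieldType) (f : {poly {poly K}}).
Hypothesis irr_f : generically_irreducible f.
Implicit Types (u v w : {poly {poly K}}).

(** A polynomial of small degree that does not vanish on the curve has a small
    order of vanishing along a branch, since this order is at most the degree of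
    the eliminant of v and f. *)
Lemma branch_order v m n (a : K) (b : {poly K}) : v != 0 ->
    (size v < size f)%N -> xdeg_le m f -> xdeg_le m v ->
    (2 * size f * m < n)%N -> ('X - a%:P) ^+ n %| f.[b] ->
  ~~ (('X - a%:P) ^+ n %| v.[b]).
Proof.
move=> v0 ltvf fm vm m_n t_f; apply/negP=> t_v.
have [s [s0 szs [u [w sE]]]] := bounded_eliminant irr_f v0 ltvf fm vm.
have : ('X - a%:P) ^+ n %| s.
  rewrite -[s](hornerC s b) sE !hornerE.
  by apply: dvdp_add; apply: dvdp_mull.
move/(dvdp_leq s0); rewrite size_exp_XsubC leqNgt => /negP[].
by rewrite ltnS (leq_trans szs).
Qed.

Hypothesis f_monic : f \is monic.
Hypothesis df_neq0 : f^`() != 0.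

Lemma separability_eliminant : exists2 r : {poly K}, r != 0 &
  exists u v, r%:P = u * f + v * f^`().
Proof.
have [m fm] := xdeg_le_exists f; have [n dfn] := xdeg_le_exists f^`().
have f0 := monic_neq0 f_monic.
have [|||r [r0 _ rE]] := bounded_eliminant (m := maxn m n) irr_f df_neq0.
- exact: lt_size_deriv.
- by apply: xdeg_leW fm; apply: leq_maxl.
- by apply: xdeg_leW dfn; apply: leq_maxr.
by exists r.
Qed.

Lemma smooth_point : exists a0 b0, f.[b0, a0] = 0 /\ f^`().[b0, a0] != 0.
Proof.
have [r r0 [u [v rE]]] := separability_eliminant.
have [a0 ra0] := closed_nonrootP _ r0.
have /closed_rootP[b0] : size (map_poly (horner_eval a0) f) != 1%N.
  rewrite (size_map_poly_id0) ?(monicP f_monic) /horner_eval ?hornerC ?oner_eq0 //.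
  apply: contra df_neq0 => /eqP szf.
  by rewrite -size_poly_eq0 -leqn0 -ltnS -szf lt_size_deriv ?monic_neq0.
move/rootP; rewrite -horner_fiber => f0; exists a0, b0; split=> //.
apply: contraNneq ra0 => df0; apply/rootP.
by rewrite -(hornerC r b0%:P) rE !hornerE f0 df0 !mulr0 addr0.
Qed.

(** This is where irreducibility is used: the e i stay independent as functions
    on the curve, and so do the products of their q-th powers with polynomials
    of degree small with respect to q. *)
Lemma Frobenius_independence (I : finType) (e g : I -> {poly {poly K}}) M m q u :
    [pchar K].-nat q ->
    (forall i, size (e i) < size f)%N -> (forall i, xdeg_le M (e i)) ->
    (forall c : I -> K, \sum_i (c i)%:P *: e i = 0 -> forall i, c i = 0) ->
    (forall i, size (g i) < size f)%N -> (forall i, xdeg_le m (g i)) ->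
    xdeg_le M f -> xdeg_le m f -> (2 * size f * m < q)%N ->
    \sum_i g i * e i ^+ q = u * f ->
  forall i, g i = 0.
Proof.
move=> char_q sz_e e_M e_free sz_g g_m f_M f_m m_q sumE.
have f_gt0 : (0 < size f)%N by rewrite size_poly_gt0 monic_neq0.
have q_gt0 : (0 < q)%N by apply: leq_ltn_trans m_q.
have [a [b0 [f0 df0]]] := smooth_point.
pose t := 'X - a%:P; have t0 : t != 0 by rewrite polyXsubC_eq0.
pose N := (2 * size f * M).+1.
have [b f_b] := Hensel_branch (N * q) f0 df0; rewrite -/t in f_b.
pose om i k := taylor_coef a (e i).[b] k.
pose uu k := \sum_i (om i k ^+ q)%:P *: g i.
pose n0 := (N + \max_i size (e i).[b])%N.
have e_b i : (e i).[b] = \sum_(k < n0) om i k *: t ^+ k.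
  apply: taylor_sum; apply: leq_trans (leq_addl _ _).
  exact: (leq_bigmax i).
have sum_b : \sum_(k < n0) t ^+ (k * q) * (uu k).[b] = u.[b] * f.[b].
  rewrite -hornerM -sumE horner_sum.
  under [RHS]eq_bigr => i _.
    rewrite hornerM horner_exp e_b power_map_sum ?pnat_pchar_poly // mulr_sumr.
    over.
  rewrite [RHS]exchange_big; apply: eq_bigr => k _ /=.
  rewrite /uu horner_sum mulr_sumr; apply: eq_bigr => i _.
  by rewrite hornerZ exprZn -mul_polyC exprM; ring.
have small_comb (c : I -> K) (h : I -> {poly {poly K}}) r :
    (forall i, size (h i) < size f)%N -> (forall i, xdeg_le r (h i)) ->
    (size (\sum_i (c i)%:P *: h i)%R < size f)%N
    /\ xdeg_le r (\sum_i (c i)%:P *: h i).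
  move=> sz_h h_r; split.
    rewrite -(ltn_predK f_gt0) ltnS; apply: leq_trans (size_sum _ _ _) _.
    apply/bigmax_leqP=> i _; apply: leq_trans (size_scale_leq _ _) _.
    by rewrite -ltnS (ltn_predK f_gt0).
  by apply: xdeg_le_sum => i _; apply: xdeg_le_scale.
(* If uu k is the first nonzero one, every other term of sum_b has order at
   least (k + 1) q in t, so the order of uu k is at least q: too large. *)
have uu0 k : (k < N)%N -> uu k = 0.
  elim/ltn_ind: k => k IHk ltkN; apply/eqP/negPn/negP=> uk0.
  have [sz_u u_m] := small_comb (fun i => om i k ^+ q) g m sz_g g_m.
  have lekN : (k.+1 * q <= N * q)%N by rewrite leq_mul2r ltkN orbT.
  have /negP[] := branch_order uk0 sz_u f_m u_m m_q
    (dvdp_trans (dvdp_exp2l _ (leq_trans (leq_pmull q (ltn0Sn k)) lekN)) f_b).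
  have ltkn : (k < n0)%N by apply: leq_trans ltkN (leq_addr _ _).
  rewrite -(dvdp_mul2l _ _ (expf_neq0 (k * q) t0)) -exprD -/t addnC -mulSn.
  move: sum_b; rewrite (bigD1 (Ordinal ltkn)) //= => /(canRL (addrK _)) ->.
  apply: dvdp_add.
    by apply: dvdp_mull; apply: dvdp_trans (dvdp_exp2l _ lekN) f_b.
  rewrite dvdpNr; elim/big_ind: _ => [|x y|j neq_j].
  - exact: dvdp0.
  - exact: dvdp_add.
  have [ltjk | lekj] := ltnP j k.
    by rewrite (IHk _ ltjk (ltn_trans ltjk ltkN)) horner0 mulr0 dvdp0.
  apply/dvdp_mulr/dvdp_exp2l; rewrite leq_mul2r; apply/orP; right.
  rewrite ltn_neqAle lekj andbT eq_sym.
  by apply: contra neq_j => /eqP jk; apply/eqP/val_inj.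
(* Taking q-th roots turns the relations into the vanishing, to order N on the
   branch, of a combination of the e i, which has order less than N unless it
   is 0. *)
have om0 (c : I -> K) : (forall k, (k < N)%N -> \sum_i om i k ^+ q * c i = 0) ->
    forall i, c i = 0.
  move=> c_om; have [mu muE] :=
    @fin_all_exists _ _ _ (fun i => closed_rootn (c i) q_gt0).
  suff mu0 i : mu i = 0 by move=> i; rewrite -muE mu0 expr0n eqn0Ngt q_gt0.
  apply: e_free; set w := \sum_i _; apply/eqP/negPn/negP=> w0.
  have [sz_w w_M] := small_comb mu e M sz_e e_M.
  have Nq : (N <= N * q)%N by rewrite leq_pmulr.
  have /negP[] := branch_order w0 sz_w f_M w_M (leqnn _)
    (dvdp_trans (dvdp_exp2l _ Nq) f_b).
  apply: taylor_dvd => k ltkN; apply/eqP; rewrite -[_ == 0]andTb -q_gt0 -expf_eq0.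
  have -> : taylor_coef a w.[b] k = \sum_i om i k * mu i.
    rewrite /taylor_coef horner_sum linear_sum coef_sum; apply: eq_bigr => j _.
    by rewrite hornerZ /= comp_polyM comp_polyC coefCM mulrC.
  rewrite power_map_sum // -[X in _ == X](c_om k ltkN); apply/eqP/eq_bigr => j _.
  by rewrite exprMn muE.
move=> i; apply/polyP=> l; apply/polyP=> k; rewrite !coef0.
apply: (om0 (fun i => (g i)`_l`_k)) => n /uu0 un0.
have := congr1 (fun v : {poly {poly K}} => v`_l`_k) un0.
rewrite !coef0 !coef_sum => sum0; rewrite -[RHS]sum0; apply: eq_bigr => j _.
by rewrite coefZ coefCM.
Qed.
End Nonvanishing.

(** * The auxiliary polynomial *)

Section Monomials.
Variable K : closedFieldType.

Definition mono (i j : nat) : {poly {poly K}} := ('X^i)%:P * 'X^j.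

Lemma coef_mono i j k l : (mono i j)`_l`_k = ((k == i) && (l == j))%:R.
Proof.
rewrite /mono coefCM coefXn.
by case: (l == j); rewrite ?mulr1 ?mulr0 ?coef0 ?coefXn ?andbT ?andbF.
Qed.

Lemma horner_mono i j a b : (mono i j).[b, a] = a ^+ i * b ^+ j.
Proof. by rewrite !hornerE. Qed.

Lemma mono_exp i j n : mono i j ^+ n = mono (i * n) (j * n).
Proof. by rewrite /mono exprMn -rmorphXn -!exprM. Qed.

Lemma size_mono i j : (size (mono i j) <= j.+1)%N.
Proof.
rewrite /mono mul_polyC; apply: leq_trans (size_scale_leq _ _) _.
by rewrite size_polyXn.
Qed.

Lemma xdeg_mono i j : xdeg_le i (mono i j).
Proof.
rewrite -{1}[i]addn0; apply: xdeg_leM; last exact: xdeg_leXn.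
by apply: xdeg_leC; rewrite size_polyXn.
Qed.

Definition bipoly n d (c : 'I_n * 'I_d -> K) : {poly {poly K}} :=
  \sum_u (c u)%:P *: mono u.1 u.2.

Lemma coef_bipoly n d (c : 'I_n * 'I_d -> K) (u : 'I_n * 'I_d) :
  (bipoly c)`_u.2`_u.1 = c u.
Proof.
rewrite /bipoly !coef_sum (bigD1 u) //= coefZ coefCM coef_mono !eqxx mulr1.
rewrite big1 ?addr0 // => v neq_v; rewrite coefZ coefCM coef_mono.
case: andP => [[/eqP e1 /eqP e2]|_]; last by rewrite mulr0.
by case/eqP: neq_v; case: u v e1 e2 => [u1 u2] [v1 v2] /= /val_inj-> /val_inj->.
Qed.

Lemma size_bipoly n d (c : 'I_n * 'I_d -> K) : (size (bipoly c) <= d)%N.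
Proof.
apply: leq_trans (size_sum _ _ _) _; apply/bigmax_leqP=> u _.
apply: leq_trans (size_scale_leq _ _) _.
exact: leq_trans (size_mono _ _) (ltn_ord _).
Qed.

Lemma xdeg_bipoly n d (c : 'I_n * 'I_d -> K) : xdeg_le n (bipoly c).
Proof.
apply: xdeg_le_sum => u _; apply: xdeg_le_scale.
by apply: xdeg_leW (xdeg_mono _ _); apply: ltnW.
Qed.

Lemma horner_bipoly n d (c : 'I_n * 'I_d -> K) a b :
  (bipoly c).[b, a] = \sum_u c u * (a ^+ u.1 * b ^+ u.2).
Proof.
rewrite /bipoly !horner_sum; apply: eq_bigr => u _.
by rewrite !hornerZ hornerM hornerC horner_mono.
Qed.
End Monomials.

(** The coefficients of (f(Y) - f(b)) / (Y - b) in Y are the quotients of f by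
    the powers of X (those of Horner's scheme), evaluated at b. *)
Lemma divided_difference (R : comNzRingType) (f : {poly R}) n (b B : R) :
    (size f <= n.+1)%N ->
  f.[B] - f.[b] = (B - b) * \sum_(j < n) (drop_poly j.+1 f).[b] * B ^+ j.
Proof.
move=> sz_f; pose D j := (drop_poly j f).[b].
have DS j : D j = D j.+1 * b + f`_j.
  rewrite /D; have -> : drop_poly j f = drop_poly j.+1 f * 'X + (f`_j)%:P.
    apply/polyP=> i; rewrite coefD coefMX coefC !coef_drop_poly.
    by case: i => [|i] /=; rewrite ?add0r // addr0 addSnnS.
  by rewrite !hornerE.
rewrite -[(_ - _) * _]/((B - b) * \sum_(j < n) D j.+1 * B ^+ j).
have sumE k : (B - b) * \sum_(j < k) D j.+1 * B ^+ j =
    D k * B ^+ k + \sum_(j < k) f`_j * B ^+ j - D 0%N.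
  elim: k => [|k IHk]; first by rewrite !big_ord0 mulr0 expr0; ring.
  by rewrite !big_ord_recr /= mulrDr IHk [D k]DS exprS; ring.
rewrite sumE {2}/D drop_poly0l; congr (_ - _).
rewrite (horner_coef_wide _ sz_f) big_ord_recr /= addrC; congr (_ * _ + _).
by rewrite DS {1}/D drop_poly_eq0 // horner0 mul0r add0r.
Qed.

Section Auxiliary.
Variables (K : closedFieldType) (f : {poly {poly K}}) (d D M I s : nat).
Hypothesis f_monic : f \is monic.
Hypothesis size_f : size f = d.+1.
Hypothesis f_D : xdeg_le D f.
Hypothesis char_M : [pchar K].-nat M.
Let E := (I + M * s + D + D * (M * d + d)).+1.
Hypothesis enough : (d.-1 * E < d * I * s)%N.

Let comb (c : ('I_I * 'I_d) * ('I_s * 'I_d)) (j : 'I_d.-1) :=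
  ((c.1.2 == j :> nat)%:R - (c.1.2 == d.-1 :> nat)%:R * drop_poly j.+1 f)
    * mono K (c.1.1 + M * c.2.1) (M * c.2.2).

Let size_comb c j : (size (comb c j) <= M * d + d)%N.
Proof.
apply: leq_trans (size_polyMleq _ _) _.
have := size_mono K (c.1.1 + M * c.2.1) (M * c.2.2).
set u := _ - _; have : (size u <= d)%N.
  apply: leq_trans (size_polyD _ _) _; rewrite geq_max size_polyN.
  have d_gt0 : (0 < d)%N by apply: leq_ltn_trans (ltn_ord c.1.2).
  apply/andP; split.
    by case: (_ == _); rewrite ?size_poly1 ?size_poly0.
  case: (_ == _); rewrite ?mul1r ?mul0r ?size_poly0 //.
  by rewrite size_drop_poly size_f subSS leq_subr.
have : (M * c.2.2 <= M * d)%N by rewrite leq_mul2l ltnW ?orbT.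
by size_lia.
Qed.

Let xdeg_comb c j : xdeg_le (I + M * s + D) (comb c j).
Proof.
rewrite addnC; apply: xdeg_leM; last first.
  apply: xdeg_leW (xdeg_mono _ _ _).
  by rewrite leq_add ?leq_mul2l ?(ltnW (ltn_ord _)) ?orbT.
have b_le (b : bool) : xdeg_le 0 (b%:R : {poly {poly K}}).
  by case: b => i; rewrite ?coef0 ?coef1 ?size_poly0 //; case: eqP => _;
    rewrite ?size_poly1 ?size_poly0.
apply: xdeg_leD; first by apply: xdeg_leW (leq0n _) (b_le _).
apply/xdeg_leN; rewrite -[D]add0n; apply: xdeg_leM => // i.
by rewrite coef_drop_poly.
Qed.

(** A linear system for the M-th powers of the unknown coefficients.  The
    power B^(d-1) is eliminated by means of the divided difference, which is
    monic of degree d - 1 in B; it then suffices that the coefficients of the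
    d - 1 remaining powers of B vanish modulo f. *)
Lemma auxiliary_coefficients : exists c : ('I_I * 'I_d) -> ('I_s * 'I_d) -> K,
  (exists u v, c u v != 0) /\
  forall a b B, f.[b, a] = 0 ->
    \sum_(j < d) (drop_poly j.+1 f).[b, a] * B ^+ j = 0 ->
  \sum_u (\sum_v c u v ^+ M * (a ^+ (M * v.1) * b ^+ (M * v.2)))
     * (a ^+ u.1 * B ^+ u.2) = 0.
Proof.
have M_gt0 : (0 < M)%N by case/andP: char_M.
pose A c (j : 'I_d.-1 * ('I_d * 'I_E)) :=
  (Pdiv.Ring.rmodp (comb c j.1) f)`_j.2.1`_j.2.2.
have [|c0 [[u0 c0_neq0] c0P]] := underdetermined_solvable A.
  rewrite !card_prod !card_ord.
  have d_gt0 : (0 < d)%N by move: enough; case: (d); rewrite ?mul0n.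
  have -> : (I * d * (s * d) = d * (d * I * s))%N by ring.
  by rewrite mulnCA ltn_pmul2l.
have [r rP] := @fin_all_exists _ _ _ (fun u => closed_rootn (c0 u) M_gt0).
exists (fun u v => r (u, v)); split.
  exists u0.1, u0.2; rewrite -surjective_pairing.
  by apply: contraNneq c0_neq0 => r0; rewrite -rP r0 expr0n eqn0Ngt M_gt0.
move=> a b B fab f1.
have comb0 j : \sum_u c0 u * (comb u j).[b, a] = 0.
  pose u := \sum_u (c0 u)%:P *: comb u j.
  have u_D : xdeg_le (I + M * s + D) u.
    by apply: xdeg_le_sum => c _; apply: xdeg_le_scale.
  have sz_u : (size u <= M * d + d)%N.
    apply: leq_trans (size_sum _ _ _) _; apply/bigmax_leqP=> c _.
    exact: leq_trans (size_scale_leq _ _) _.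
  have : Pdiv.Ring.rmodp u f = 0.
    apply/polyP=> l; rewrite coef0.
    have [ltld | ledl] := ltnP l d; last first.
      rewrite nth_default // (leq_trans _ ledl) // -ltnS -size_f.
      by rewrite Pdiv.Ring.ltn_rmodpN0 ?monic_neq0.
    apply/polyP=> k; rewrite coef0.
    have [ltkE | leEk] := ltnP k E; last first.
      by rewrite nth_default // (leq_trans (xdeg_le_rmodp f_monic f_D u_D sz_u l)).
    have := c0P (j, (Ordinal ltld, Ordinal ltkE)); rewrite /A /= => sum0.
    rewrite -[RHS]sum0 Pdiv.RingMonic.rmodp_sum // !coef_sum.
    by apply: eq_bigr => c _; rewrite Pdiv.RingMonic.rmodpZ // coefZ coefCM.
  move=> u_f0; have : u.[b, a] = 0.
    rewrite (Pdiv.RingMonic.rdivp_eq f_monic u) u_f0 addr0.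
    by rewrite !hornerM fab mulr0.
  rewrite !horner_sum => sum0; rewrite -[RHS]sum0; apply: eq_bigr => c _.
  by rewrite !hornerE.
(* The reduction of a power of B modulo the divided difference. *)
have reduceB (u : nat) : (u < d)%N -> B ^+ u = \sum_(j < d.-1)
    ((u == j :> nat)%:R - (u == d.-1 :> nat)%:R * (drop_poly j.+1 f).[b, a]) * B ^+ j.
  move=> ltud; have dE : d.-1.+1 = d by apply: prednK; apply: leq_ltn_trans ltud.
  under eq_bigr => j _ do rewrite mulrBl.
  rewrite sumrB; have [ud | ud] := eqVneq u d.-1.
    rewrite big1 ?sub0r => [|j _]; last first.
      by rewrite ud gtn_eqF ?mul0r.
    have : \sum_(j < d.-1.+1) (drop_poly j.+1 f).[b, a] * B ^+ j = 0 by rewrite dE.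
    rewrite big_ord_recr /= dE.
    have -> : drop_poly d f = 1.
      rewrite [drop_poly d f]size1_polyC ?size_drop_poly ?size_f ?subSnn //.
      rewrite coef_drop_poly add0n -[d]/(d.+1.-1) -size_f -/(lead_coef f).
      by rewrite (monicP f_monic).
    rewrite !hornerE ?mul1r ud addrC => /(canRL (addrK _)) ->; rewrite sub0r.
    by congr (- _); apply: eq_bigr => j _; rewrite mul1r.
  have {}ltud : (u < d.-1)%N by rewrite ltn_neqAle ud -ltnS dE.
  rewrite (bigD1 (Ordinal ltud)) //= eqxx mul1r !big1 ?addr0 ?subr0 // => j.
    by rewrite !mul0r.
  move=> neq_j; rewrite eq_sym (_ : (j == u :> nat) = false) ?mul0r //.
  exact: negPf.
transitivity (\sum_(j < d.-1) (\sum_u c0 u * (comb u j).[b, a]) * B ^+ j); last first.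
  by apply: big1 => j _; rewrite comb0 mul0r.
under [RHS]eq_bigr => j _ do rewrite mulr_suml.
rewrite exchange_big /=; under eq_bigr => u _ do rewrite mulr_suml.
rewrite pair_bigA /=; apply: eq_bigr => -[u v] _ /=.
rewrite rP (reduceB _ (ltn_ord _)) !mulr_sumr; apply: eq_bigr => j _.
have ev_bool (t : bool) : (t%:R : {poly {poly K}}).[b, a] = t%:R.
  by case: t; rewrite ?hornerC.
by rewrite /comb /mono /= !hornerE !ev_bool exprD /=; ring.
Qed.
End Auxiliary.

(** * Rational points on monic curves *)

Section FrobeniusAction.
Variables (K : closedFieldType) (m : nat) (char_m : [pchar K].-nat m).

Definition Frobenius_twist (u : {poly {poly K}}) : {poly {poly K}} :=
  map_poly (map_poly (power_map char_m)) u.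

Lemma horner_Frobenius_twist u a b :
  (Frobenius_twist u).[b ^+ m, a ^+ m] = u.[b, a] ^+ m.
Proof.
rewrite -[RHS]/(power_map char_m u.[b, a]) -horner_map -horner_map /= map_polyC /=.
by [].
Qed.

Lemma coef_Frobenius_twist u i j : (Frobenius_twist u)`_i`_j = u`_i`_j ^+ m.
Proof. by rewrite !coef_map. Qed.
End FrobeniusAction.

Lemma expr_fixed_iter (K : nzRingType) (x : K) q n :
  x ^+ q = x -> x ^+ (q ^ n) = x.
Proof. by move=> xq; elim: n => [|n IHn]; rewrite ?expr1 // expnSr exprM IHn. Qed.

Lemma size_filter_notin (T : eqType) (S B : seq T) : uniq S ->
  (size S <= size [seq x <- S | x \notin B] + size B)%N.
Proof.
move=> S_uniq; rewrite -(count_predC [in B] S) addnC size_filter leq_add2l.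
rewrite -size_filter; apply: uniq_leq_size; first exact: filter_uniq.
by move=> x; rewrite mem_filter => /andP[].
Qed.

Section CharacteristicPowers.
Variables (K : closedFieldType) (p : nat).
Hypothesis charKp : p \in [pchar K].

Lemma pnat_expn m : [pchar K].-nat (p ^ m)%N.
Proof.
by rewrite (eq_pnat _ (pcharf_eq charKp)) pnatX pnat_id ?(pcharf_prime charKp).
Qed.

Lemma pnat_q e m : [pchar K].-nat ((p ^ e) ^ m)%N.
Proof. by rewrite -expnM pnat_expn. Qed.
End CharacteristicPowers.

Section MonicPoints.
Variables (K : closedFieldType) (p e : nat).
Hypotheses (charKp : p \in [pchar K]) (e_gt0 : (0 < e)%N).
Let q := (p ^ e)%N.
Variable f : {poly {poly K}}.
Hypothesis irr_f : generically_irreducible f.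
Hypothesis f_monic : f \is monic.
Hypothesis df_neq0 : f^`() != 0.
Hypothesis f_rat : forall i j, f`_i`_j ^+ q = f`_i`_j.

Let q_gt1 : (1 < q)%N.
Proof. by rewrite -(expn0 p) ltn_exp2l ?prime_gt1 ?(pcharf_prime charKp). Qed.

Lemma conjugate_root n a b : a ^+ (q ^ n) = a -> f.[b, a] = 0 ->
  f.[b ^+ (q ^ n), a] = 0.
Proof.
move=> aQ fab; rewrite -[a in LHS]aQ.
have -> : f = Frobenius_twist (pnat_q charKp e n) f.
  apply/polyP=> i; apply/polyP=> j.
  by rewrite coef_Frobenius_twist expr_fixed_iter.
by rewrite horner_Frobenius_twist fab expr0n eqn0Ngt expn_gt0 (ltnW q_gt1).
Qed.

(** When the eliminant r of f and df/dy does not vanish at a, f(a, y) and its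
    derivative are coprime, so f(a, y) has as many roots as its degree. *)
Lemma fiber_roots (a : K) (r : {poly K}) :
    (exists u v, r%:P = u * f + v * f^`()) -> ~~ root r a ->
  exists2 rs, uniq rs & size rs = (size f).-1 /\ forall b, b \in rs -> f.[b, a] = 0.
Proof.
move=> [u [v rE]] ra0; pose fa := map_poly (horner_eval a) f.
have fa_monic : fa \is monic by apply: monic_map.
have [rs fE] := closed_field_poly_normal fa.
rewrite (monicP fa_monic) scale1r in fE.
exists rs; last split.
- rewrite -separable_prod_XsubC -fE unlock; apply: Pdiv.ClosedField.root_coprimep => b.
  rewrite /fa deriv_map => /rootP; rewrite -!horner_fiber => fab.
  apply: contraNneq ra0 => dfab; apply/rootP.
  by rewrite -(hornerC r b%:P) rE !hornerE fab dfab !mulr0 addr0.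
- rewrite -(@size_map_poly_id0 _ _ (horner_eval a) f) -/fa.
    by rewrite fE (size_prod_XsubC rs id).
  by rewrite (monicP f_monic) /= horner_evalE hornerC oner_eq0.
move=> b; rewrite -root_prod_XsubC -fE => /rootP.
by rewrite -horner_fiber.
Qed.

(** If all points over GF(q^n) had their x in B, the auxiliary polynomial H
    below would vanish on so many fibers that f would divide it, against
    Frobenius_independence. *)
Theorem monic_curve_points (B : seq K) : exists n0, forall n, (n0 <= n)%N ->
  exists a b, [/\ a ^+ (q ^ n) = a, b ^+ (q ^ n) = b, f.[b, a] = 0 & a \notin B].
Proof.
have [D f_D] := xdeg_le_exists f.
pose d := (size f).-1.
have df_size : (size f^`() < size f)%N by apply: lt_size_deriv; apply: monic_neq0.
have sz_f : size f = d.+1.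
  by rewrite /d prednK // (leq_ltn_trans _ df_size).
have d_gt0 : (0 < d)%N.
  by rewrite -ltnS -sz_f (leq_trans _ df_size) // ltnS size_poly_gt0.
have [r r0 rE] := separability_eliminant irr_f f_monic df_neq0.
have [rr rrP] := roots_listed r0.
(* The degree in x of H mod f is at most (I + D (d - 1)) q' up to a constant,
   whence I = M - C to keep it below M q' = q^n; the linear system then has a
   solution if (d - 1) M < d I, that is d C < M, and s is large. *)
pose C := (D * d).+1; pose mu := (d * C)%N; pose M := (q ^ mu)%N.
have M_big : (d * C < M)%N by apply: ltn_expl.
pose I := (M - C)%N.
pose c0 := (I + D + D * (M * d + d)).+1.
pose s := (d * c0).+1.
pose m := maxn s D.
pose bad := size (B ++ rr).
exists (mu + (2 * size f * m + m + D * d + bad).+1)%N => n le_n.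
pose q' := (q ^ (n - mu))%N.
have Qe : (q ^ n = M * q')%N by rewrite /M /q' -expnD subnKC //; lia.
have q'_big : (2 * size f * m + m + D * d + bad < q')%N.
  apply: leq_trans (ltn_expl _ q_gt1).
  by rewrite ltnS; lia.
have [S [S_uniq sz_S SP]] : exists S : seq K, [/\ uniq S, size S = (q ^ n)%N &
   forall x, (x \in S) = (x ^+ (q ^ n) == x)].
  have n_gt0 : (0 < e * n)%N by rewrite muln_gt0 e_gt0 (leq_trans _ le_n) // addnS.
  have [_ [S [S_uniq sz_S SP]]] := finite_subfield_exists charKp n_gt0.
  by exists S; split; rewrite /q -?expnM // => x; rewrite -SP inE.
have [/hasP[[a b]] | /hasPn no_pt] := boolP (has
    (fun x : K * K => (f.[x.2, x.1] == 0) && (x.1 \notin B))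
    [seq (a, b) | a <- S, b <- S]).
  case/allpairsP=> -[a' b'] /= [aS bS [-> ->]] /andP[/eqP fab aB].
  by exists a', b'; split=> //; apply/eqP; rewrite -SP.
have M_d : (d.-1 * M < d * I)%N.
  rewrite /I mulnBr; have : (M <= d * M)%N by rewrite leq_pmull.
  by rewrite -subn1 mulnBl mul1n; move: (d * M)%N (d * C)%N M_big => x y; lia.
have enough : (d.-1 * (I + M * s + D + D * (M * d + d)).+1 < d * I * s)%N.
  have : ((d.-1 * M).+1 * s <= d * I * s)%N by rewrite leq_mul2r M_d orbT.
  apply: leq_trans.
  have -> : (I + M * s + D + D * (M * d + d)).+1 = (c0 + M * s)%N by rewrite /c0; lia.
  rewrite mulnDr mulSn mulnA ltn_add2r ltnS leq_mul2r leq_pred orbT //.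
have char_M : [pchar K].-nat M by apply: pnat_q.
have char_q' : [pchar K].-nat q' by apply: pnat_q.
have [c [[u0 [v0 c_neq0]] cP]] :=
  auxiliary_coefficients f_monic sz_f f_D char_M enough.
pose g u := bipoly (c u).
pose e_ (u : 'I_I * 'I_d) := mono K u.1 u.2.
pose H := \sum_u g u * e_ u ^+ q'.
have g_m u : xdeg_le m (g u) by apply: xdeg_leW (xdeg_bipoly _); apply: leq_maxl.
have sz_g u : (size (g u) < size f)%N by rewrite sz_f ltnS size_bipoly.
have f_m : xdeg_le m f by apply: xdeg_leW f_D; apply: leq_maxr.
(* The computation of H(a, b) ^+ M that defines the linear system. *)
have H0 a b : a ^+ (q ^ n) = a -> a \notin B -> f.[b, a] = 0 -> H.[b, a] = 0.
  move=> aQ aB fab; apply/eqP; have M_gt0 : (0 < M)%N by apply: leq_ltn_trans M_big.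
  have fBa := conjugate_root aQ fab; set b' := b ^+ (q ^ n) in fBa.
  have neq_b : b' != b.
    apply/negP=> /eqP bQ; have /no_pt : (a, b) \in [seq (a, b) | a <- S, b <- S].
      by apply: allpairs_f; rewrite SP; apply/eqP.
    by rewrite /= fab eqxx aB.
  have f1 : \sum_(j < d) (drop_poly j.+1 f).[b, a] * b' ^+ j = 0.
    have sz_fa : (size (map_poly (horner_eval a) f) <= d.+1)%N.
      by rewrite -sz_f size_poly.
    have := divided_difference b b' sz_fa.
    rewrite -!horner_fiber fab fBa subr0 => /esym/eqP.
    rewrite mulf_eq0 subr_eq0 (negPf neq_b) /= => /eqP sum0.
    rewrite -[RHS]sum0; apply: eq_bigr => j _; congr (_ * _).
    rewrite horner_fiber; congr (_.[_]); apply/polyP=> i.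
    by rewrite !(coef_drop_poly, coef_map).
  rewrite -[_ == 0]andTb -M_gt0 -expf_eq0 /H !horner_sum power_map_sum //.
  apply/eqP; rewrite -[RHS](cP _ _ _ fab f1); apply: eq_bigr => u _.
  rewrite !hornerM !horner_exp horner_mono exprMn horner_bipoly power_map_sum //.
  congr (_ * _).
    by apply: eq_bigr => v _; rewrite !exprMn -!exprM ![(_ * M)%N]mulnC.
  rewrite -exprM [(q' * M)%N]mulnC -Qe exprMn -/b' -!exprM ![(_ * q ^ n)%N]mulnC.
  by rewrite !exprM aQ.
pose R := Pdiv.Ring.rmodp H f.
have sz_R : (size R <= d)%N.
  by rewrite -ltnS -sz_f Pdiv.Ring.ltn_rmodpN0 ?monic_neq0.
have I_gt0 : (0 < I)%N.
  by rewrite subn_gt0; apply: leq_ltn_trans M_big; rewrite leq_pmull.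
have R_small : xdeg_le (m + I.-1 * q' + D * (d + d.-1 * q')) R.
  apply: xdeg_le_rmodp => //.
    apply: xdeg_le_sum => u _; apply: xdeg_leM => //.
    rewrite /e_ mono_exp; apply: xdeg_leW (xdeg_mono _ _ _).
    by rewrite leq_mul2r -ltnS prednK // ltn_ord orbT.
  apply: leq_trans (size_sum _ _ _) _; apply/bigmax_leqP=> u _.
  apply: leq_trans (size_polyMleq _ _) _; rewrite /e_ mono_exp.
  have := size_mono K (u.1 * q') (u.2 * q'); have := size_bipoly (c u).
  have : (u.2 * q' <= d.-1 * q')%N by rewrite leq_mul2r -ltnS prednK // ltn_ord orbT.
  by rewrite -/(g u); size_lia.
have R0 : R = 0.
  apply/polyP=> l; rewrite coef0.
  apply: (@roots_geq_poly_eq0 _ _ [seq x <- S | x \notin B ++ rr]).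
  - apply/allP=> a; rewrite mem_filter mem_cat negb_or -rrP SP.
    case/andP=> /andP[aB ra0] /eqP aQ.
    have [rs rs_uniq [sz_rs rsP]] := fiber_roots rE ra0.
    have : map_poly (horner_eval a) R = 0.
      apply: (@roots_geq_poly_eq0 _ _ rs) => //.
        apply/allP=> b /rsP fab; rewrite rootE -horner_fiber.
        have := H0 a b aQ aB fab.
        rewrite {1}(Pdiv.RingMonic.rdivp_eq f_monic H) -/R !hornerE fab mulr0 add0r.
        by move->.
      by rewrite sz_rs -/d (leq_trans (size_poly _ _)).
    by move/(congr1 (fun P : {poly K} => P`_l)); rewrite coef_map coef0 => /rootP.
  - exact: filter_uniq.
  apply: leq_trans (R_small l) _.
  have := size_filter_notin (B ++ rr) S_uniq; rewrite -/bad sz_S Qe.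
  have : (I.-1 * q' + q' + D * d * q' + q' = M * q')%N.
    have -> : M = (I.-1 + 1 + D * d + 1)%N.
      by move: I_gt0; rewrite /I /C; lia.
    by rewrite !mulnDl !mul1n.
  have : (D * d.-1 * q' <= D * d * q')%N by rewrite leq_mul2r leq_mul2l leq_pred !orbT.
  move: q'_big; rewrite mulnDr mulnA.
  move: (2 * size f * m)%N (I.-1 * q')%N (D * d * q')%N (D * d.-1 * q')%N.
  move: (M * q')%N (D * d)%N.
  by move: (size _) => k x1 x2 x3 x4 x5 x6; lia.
have HE : \sum_u g u * e_ u ^+ q' = Pdiv.Ring.rdivp H f * f.
  by rewrite -/H {1}(Pdiv.RingMonic.rdivp_eq f_monic H) -/R R0 addr0.
have g0 u : g u = 0.
  move: u; apply: (Frobenius_independence (M := maxn I D) (m := m)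
    irr_f f_monic df_neq0 char_q' _ _ _ sz_g g_m _ f_m _ HE).
  - by move=> u; rewrite sz_f ltnS; apply: leq_trans (size_mono _ _ _) (ltn_ord _).
  - move=> u; apply: xdeg_leW (xdeg_mono _ _ _).
    by apply: leq_trans (leq_maxl _ _); apply: ltnW.
  - by move=> k k0 u; rewrite -(coef_bipoly k u) /bipoly k0 !coef0.
  - by apply: xdeg_leW f_D; apply: leq_maxr.
  by move: q'_big; lia.
by case/eqP: c_neq0; rewrite -(coef_bipoly (c u0) v0) -/(g u0) g0 !coef0.
Qed.
End MonicPoints.

(** * Rational points on absolutely irreducible curves *)

Section Monicization.
Variables (K : closedFieldType) (f : {poly {poly K}}).
Hypothesis size_f : (1 < size f)%N.
Let c := lead_coef f.
Let d := (size f).-1.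

Let c_neq0 : c != 0.
Proof. by rewrite lead_coef_eq0 -size_poly_gt0 ltnW. Qed.

Let sz_f : size f = d.+1.
Proof. by rewrite /d prednK // ltnW. Qed.

(** The polynomial c^(d-1) f(x, y / c), where c is the leading coefficient
    of f. *)
Definition monicization : {poly {poly K}} :=
  \poly_(i < d.+1) (if i == d then 1 else f`_i * c ^+ (d.-1 - i)).

Lemma size_monicization : size monicization = size f.
Proof. by rewrite sz_f size_poly_eq // eqxx oner_eq0. Qed.

Lemma monicization_monic : monicization \is monic.
Proof.
by rewrite monicE /lead_coef size_monicization sz_f coef_poly ltnSn eqxx.
Qed.

Let size_cX : size (c *: 'X : {poly {poly K}}) = 2.
Proof. by rewrite size_scale // size_polyX. Qed.

Lemma coef_comp_scaleX (u : {poly {poly K}}) i :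
  (u \Po (c *: 'X))`_i = u`_i * c ^+ i.
Proof.
rewrite comp_polyE coef_sum.
under eq_bigr => j _ do rewrite exprZn coefZ coefZ coefXn.
have [lt_i | le_i] := ltnP i (size u); last first.
  rewrite nth_default // mul0r big1 // => j _.
  by rewrite gtn_eqF ?mulr0 // (leq_trans _ le_i).
rewrite (bigD1 (Ordinal lt_i)) //= eqxx mulr1 big1 ?addr0 // => j neq_j.
by rewrite eq_sym (_ : (j == i :> nat) = false) ?mulr0 //; apply: negPf.
Qed.

Lemma monicization_comp : monicization \Po (c *: 'X) = c ^+ d.-1 *: f.
Proof.
apply/polyP=> i; rewrite coef_comp_scaleX coefZ coef_poly.
have d_gt0 : (0 < d)%N by rewrite -ltnS -sz_f.
case: ltnP => [|ltdi]; last by rewrite nth_default ?sz_f // mulr0 mul0r.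
rewrite ltnS; case: eqP => [-> _|/eqP neq_id le_id].
  by rewrite mul1r -[f`_d]/(lead_coef f) -/c -exprSr prednK.
rewrite -mulrA -exprD subnK; first exact: mulrC.
by rewrite -ltnS prednK // ltn_neqAle neq_id.
Qed.

Lemma monicization_irreducible :
  generically_irreducible f -> generically_irreducible monicization.
Proof.
move=> irr_f c' e w c'0 E.
have := irr_f (c' * c ^+ d.-1) (e \Po (c *: 'X)) (w \Po (c *: 'X)).
rewrite !size_comp_poly2 //; apply; first by rewrite mulf_neq0 ?expf_neq0.
by rewrite -scalerA -monicization_comp -comp_polyZ E comp_polyM.
Qed.

Lemma monicization_deriv : f^`() != 0 -> monicization^`() != 0.
Proof.
apply: contra_neq => dm0; have := congr1 (@deriv _) monicization_comp.
rewrite deriv_comp dm0 comp_poly0 mul0r derivZ => /esym/eqP.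
by rewrite scale_poly_eq0 expf_eq0 (negPf c_neq0) andbF => /eqP.
Qed.

Lemma horner_monicization a b :
  monicization.[c.[a] * b, a] = c.[a] ^+ d.-1 * f.[b, a].
Proof.
have := congr1 (fun u : {poly {poly K}} => u.[b, a]) monicization_comp.
rewrite /= horner_comp !hornerE => <-.
by rewrite [RHS]horner_subst !hornerE.
Qed.
End Monicization.

Section CurvePoints.
Variables (K : closedFieldType) (p e : nat).
Hypotheses (charKp : p \in [pchar K]) (e_gt0 : (0 < e)%N).
Let q := (p ^ e)%N.
Implicit Types f g : {poly {poly K}}.

Lemma separable_curve_points f : irreducible_elt f -> f^`() != 0 ->
    (forall i j, f`_i`_j ^+ q = f`_i`_j) ->
  forall B : seq K, exists n0, forall n, (n0 <= n)%N ->
  exists a b, [/\ a ^+ (q ^ n) = a, b ^+ (q ^ n) = b, f.[b, a] = 0 & a \notin B].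
Proof.
move=> irr_f df0 f_rat B; have f0 : f != 0 by case: irr_f.
have sz_f : (1 < size f)%N.
  by apply: leq_ltn_trans (lt_size_deriv f0); rewrite size_poly_gt0.
set c := lead_coef f.
have c0 : c != 0 by rewrite lead_coef_eq0.
have [s sP] := roots_listed c0.
pose sigma := map_poly (power_map (pnat_expn charKp e)).
have f_sigma i : sigma f`_i = f`_i.
  by apply/polyP=> j; rewrite coef_map /= -[RHS]f_rat.
have sigma_rat (r : {poly K}) j : sigma r = r -> r`_j ^+ q = r`_j.
  by move=> rq; rewrite -[in RHS]rq coef_map.
have m_rat i j : (monicization f)`_i`_j ^+ q = (monicization f)`_i`_j.
  apply: sigma_rat; rewrite coef_poly; case: ifP => _; last exact: rmorph0.
  case: ifP => _; first exact: rmorph1.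
  by rewrite /sigma rmorphM rmorphXn /= -/sigma !f_sigma.
have m_monic := monicization_monic sz_f.
have m_irr := monicization_irreducible sz_f (irreducible_generically irr_f).
have m_sep := monicization_deriv sz_f df0.
have [n0 n0P] := monic_curve_points charKp e_gt0 m_irr m_monic m_sep m_rat (B ++ s).
exists n0 => n /n0P[a [b [aQ bQ fab]]]; rewrite mem_cat negb_or -sP => /andP[aB ca0].
exists a, (b / c.[a]); split=> //.
  rewrite expr_div_n bQ; congr (_ / _).
  (* The leading coefficient takes its values at rational points in GF(q^n). *)
  have cE : map_poly (power_map (pnat_q charKp e n)) c = c.
    by apply/polyP=> j; rewrite coef_map /= /power_map expr_fixed_iter ?f_rat.
  rewrite -[LHS]/(power_map (pnat_q charKp e n) c.[a]) -horner_map cE.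
  by congr c.[_].
have := horner_monicization sz_f a (b / c.[a]).
rewrite -/c mulrC divfK // fab => /esym/eqP; rewrite /root in ca0.
by rewrite mulf_eq0 expf_eq0 (negPf ca0) andbF /= => /eqP.
Qed.

Lemma irreducible_swapXY f : irreducible_elt f -> irreducible_elt (swapXY f).
Proof.
have swap_unit (u : {poly {poly K}}) :
    (swapXY u \is a GRing.unit) = (u \is a GRing.unit).
  apply/idP/idP => [Uu|]; last exact: rmorph_unit.
  by rewrite -[u]swapXYK rmorph_unit.
case=> f0 f_nu f_fact; split; rewrite ?swapXY_eq0 ?swap_unit // => v w vw.
rewrite -(swap_unit v) -(swap_unit w).
by apply: f_fact; rewrite -[LHS]swapXYK vw; apply: rmorphM.
Qed.

(** Otherwise f would be a p-th power. *)
Lemma irreducible_separable f : irreducible_elt f ->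
  f^`() != 0 \/ (swapXY f)^`() != 0.
Proof.
move=> [f0 f_nu f_fact]; have [df0 | ] := eqVneq f^`() 0; last by left.
have [df0' | ] := eqVneq (swapXY f)^`() 0; last by right.
have p_gt1 := prime_gt1 (pcharf_prime charKp).
have [v vE] := deriv0_pth_power2 charKp df0 df0'.
have : v \is a GRing.unit.
  have := f_fact v (v ^+ p.-1); rewrite -exprS prednK ?(ltnW p_gt1) //.
  case/(_ vE) => //; rewrite unitrX_pos //; lia.
by move=> Uv; rewrite vE unitrX in f_nu.
Qed.

Theorem irreducible_curve_points f : irreducible_elt f ->
    (forall i j, f`_i`_j ^+ q = f`_i`_j) ->
  exists n0, forall n, (n0 <= n)%N -> exists a b,
    [/\ a ^+ (q ^ n) = a, b ^+ (q ^ n) = b, f.[b, a] = 0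
      & ~~ ((a ^+ q == a) && (b ^+ q == b))].
Proof.
move=> irr_f f_rat.
have [_ [B [_ _ BP]]] := finite_subfield_exists charKp e_gt0.
have notB a : a \notin B -> a ^+ q != a by rewrite -BP inE.
have [df0 | df0] := irreducible_separable irr_f.
  have [n0 n0P] := separable_curve_points irr_f df0 f_rat B.
  exists n0 => n /n0P[a [b [aQ bQ fab /notB aB]]]; exists a, b; split=> //.
  by rewrite (negPf aB).
have [|n0 n0P] := separable_curve_points (irreducible_swapXY irr_f) df0 _ B.
  by move=> i j; rewrite coef_swapXY f_rat.
exists n0 => n /n0P[a [b [aQ bQ fab /notB aB]]]; exists b, a; split=> //.
  by rewrite -horner2_swapXY.
by rewrite (negPf aB) andbF.
Qed.
End CurvePoints.

(** * Factorization in K[x, y] and algebraic elements *)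

Section Factorization.
Variable K : closedFieldType.
Implicit Types u v w g : {poly {poly K}}.

(** A measure of nonzero polynomials that is additive on products and
    vanishes exactly on units. *)
Definition bidegree_sum u := ((size u).-1 + (size (swapXY u)).-1)%N.

Lemma bidegree_sumM v w : v != 0 -> w != 0 ->
  bidegree_sum (v * w) = (bidegree_sum v + bidegree_sum w)%N.
Proof.
move=> v0 w0; have sv0 : swapXY v != 0 by rewrite swapXY_eq0.
have sw0 : swapXY w != 0 by rewrite swapXY_eq0.
rewrite /bidegree_sum rmorphM /= !size_mul //.
move: v0 w0 sv0 sw0; rewrite -!size_poly_gt0.
move: (size v) (size w) (size (swapXY v)) (size (swapXY w)) => a b c d; lia.
Qed.

Lemma bidegree_sum0_unit u : u != 0 -> bidegree_sum u = 0%N -> u \is a GRing.unit.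
Proof.
move=> u0 /eqP; rewrite addn_eq0 -!subn1 !subn_eq0 => /andP[su su'].
move: u0; rewrite (size1_polyC su) polyC_eq0 => u00.
have: (size (u`_0)%R <= 1)%N.
  apply: leq_trans su'; rewrite -sizeYE; exact: max_size_coefXY.
move=> su0; move: u00; rewrite (size1_polyC su0) polyC_eq0 => u000.
by apply/unit_poly2P; exists u`_0`_0.
Qed.

Lemma irreducible_factorization u : u != 0 -> exists c gs,
  [/\ c \is a GRing.unit, forall g, g \in gs -> irreducible_elt g
    & u = c * \prod_(g <- gs) g].
Proof.
have [n] := ubnP (bidegree_sum u); elim: n => // n IHn in u * => ltn u0.
have [Uu | Uu] := boolP (u \is a GRing.unit).
  by exists u, [::]; rewrite big_nil mulr1.
have [irr_u | red_u] := classic (irreducible_elt u).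
  exists 1, [:: u]; rewrite unitr1 big_seq1 mul1r; split=> // g.
  by rewrite inE => /eqP->.
have [v [w [Uv Uw uE]]] : exists v w,
    [/\ v \isn't a GRing.unit, w \isn't a GRing.unit & u = v * w].
  apply: NNPP => no_fact; apply: red_u; split=> // v w uE.
  have [Uv | Uv] := boolP (v \is a GRing.unit); first by left.
  have [Uw | Uw] := boolP (w \is a GRing.unit); first by right.
  by case: no_fact; exists v, w.
move: u0; rewrite uE mulf_eq0 negb_or => /andP[v0 w0].
have pos x : x != 0 -> x \isn't a GRing.unit -> (0 < bidegree_sum x)%N.
  by move=> x0; apply: contraNltn; rewrite leqn0 => /eqP; apply: bidegree_sum0_unit.
move: ltn (pos _ v0 Uv) (pos _ w0 Uw); rewrite uE bidegree_sumM // => ltn v_pos w_pos.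
have [|c1 [gs1 [Uc1 irr1 ->]]] := IHn v _ v0; first by lia.
have [|c2 [gs2 [Uc2 irr2 ->]]] := IHn w _ w0; first by lia.
exists (c1 * c2), (gs1 ++ gs2); split; first by rewrite unitrMl.
  by move=> g; rewrite mem_cat => /orP[/irr1|/irr2].
by rewrite big_cat /= mulrACA.
Qed.
End Factorization.

Section AlgebraicElements.
Variables (p e : nat) (p_prime : prime p).
Let q := (p ^ e)%N.
Variables (K : closedFieldType) (kappa : {rmorphism 'F_p -> K}).
Hypothesis K_algebraic : integralRange kappa.

Lemma pchar_of_Fp : p \in [pchar K].
Proof. exact: (rmorph_pchar kappa (pchar_Fp p_prime)). Qed.

(** The powers of x lie in the finite ring F_p[x], so two iterates of the
    Frobenius map agree at x, and that map is injective. *)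
Lemma Frobenius_periodic (x : K) : exists2 M, (0 < M)%N & x ^+ (q ^ M) = x.
Proof.
have [P P_monic /rootP Px] : exists2 P : {poly 'F_p}, P \is monic &
  root (map_poly kappa P) x := K_algebraic x.
pose k := (size P).-1.
pose ev (v : 'rV['F_p]_k) := (map_poly kappa (rVpoly v)).[x].
have powers n : exists v, x ^+ n = ev v.
  exists (poly_rV ('X^n %% P)); rewrite /ev poly_rV_K.
    have := congr1 (fun r => (map_poly kappa r).[x]) (divp_eq 'X^n P).
    rewrite /= rmorphD rmorphM /= map_polyXn hornerD hornerM Px mulr0 add0r.
    rewrite hornerXn => powE.
    by [].
  by rewrite -ltnS prednK ?ltn_modpN0 ?size_poly_gt0 ?monic_neq0.
have [v vP] := @fin_all_exists _ _ _
  (fun i : 'I_#|{: 'rV['F_p]_k}|.+1 => powers (q ^ i)%N).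
have : ~~ injectiveb v.
  apply/injectiveP => v_inj; have := leq_card v v_inj.
  by rewrite card_ord ltnn.
case/injectivePn=> i [j neq_ij vij].
have powE : x ^+ (q ^ i) = x ^+ (q ^ j) by rewrite !vP vij.
wlog lt_ij : i j neq_ij {vij} powE / (i < j)%N => [wlog_lt|].
  have [lt_ij|lt_ji|/val_inj E] := ltngtP i j.
  - exact: (wlog_lt i j).
  - by apply: (wlog_lt j i); rewrite // eq_sym.
  - by rewrite E eqxx in neq_ij.
exists (j - i)%N; first by rewrite subn_gt0.
apply: (fmorph_inj (power_map (pnat_q pchar_of_Fp e i))).
by rewrite /= /power_map -exprM -expnD subnK // ltnW.
Qed.

Lemma common_Frobenius_period (s : seq K) :
  exists2 M, (0 < M)%N & {in s, forall x, x ^+ (q ^ M) = x}.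
Proof.
elim: s => [|x s [M M0 MP]]; first by exists 1%N.
have [Mx Mx0 MxP] := Frobenius_periodic x.
exists (M * Mx)%N; first by rewrite muln_gt0 M0.
move=> y; rewrite inE => /orP[/eqP-> | /MP My].
  by rewrite mulnC expnM expr_fixed_iter.
by rewrite expnM expr_fixed_iter.
Qed.
End AlgebraicElements.

(** * Conjugate factors and descent *)

Section Descent.
Variables (F : finFieldType) (K : closedFieldType) (iota : {rmorphism F -> K}).

Lemma codom_fixed x : (x \in codom iota) = (x ^+ #|F| == x).
Proof.
have F_gt1 : (1 < #|F|)%N by apply: card_finNzRing_gt1.
suff FK : finite_subfield #|F| [in codom iota].
  by rewrite -[LHS]/(x \in [in codom iota]) (finite_subfieldE F_gt1 FK) inE.
split; first split.
- by rewrite -(rmorph1 iota); apply: codom_f.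
- by move=> _ _ /codomP[y1 ->] /codomP[y2 ->]; rewrite -rmorphB; apply: codom_f.
- by move=> _ _ /codomP[y1 ->] /codomP[y2 ->]; rewrite -fmorph_div; apply: codom_f.
exists (codom iota); split; rewrite ?size_codom //.
by rewrite map_inj_uniq ?enum_uniq //; apply: fmorph_inj.
Qed.

Lemma coef_embed_XY (u : {poly {poly F}}) i j :
  (embed_XY iota u)`_i`_j = iota u`_i`_j.
Proof. by rewrite !coef_map. Qed.

Lemma embed_XY_inj : injective (embed_XY iota).
Proof. exact: map_inj_poly (@map_poly_inj _ _ iota) (rmorph0 _). Qed.

Lemma embed_XY_fixed (u : {poly {poly F}}) i j :
  (embed_XY iota u)`_i`_j ^+ #|F| = (embed_XY iota u)`_i`_j.
Proof. by rewrite coef_embed_XY -rmorphXn /= expf_card. Qed.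

Lemma embed_XY_descent (u : {poly {poly K}}) :
  (forall i j, u`_i`_j ^+ #|F| = u`_i`_j) -> exists v, u = embed_XY iota v.
Proof.
move=> u_fix; pose pre x := odflt 0 [pick y | iota y == x].
exists (\poly_(i < size u) \poly_(j < size u`_i) pre u`_i`_j).
apply/polyP=> i; apply/polyP=> j; rewrite coef_embed_XY coef_poly.
case: ltnP => [_|le_i]; last by rewrite [u`_i]nth_default // !coef0 rmorph0.
rewrite coef_poly; case: ltnP => [_|le_j]; last by rewrite nth_default ?rmorph0.
rewrite /pre; case: pickP => [y /eqP-> // | none].
have /codomP[y yE] : u`_i`_j \in codom iota by rewrite codom_fixed u_fix.
by have := none y; rewrite yE eqxx.
Qed.
End Descent.

Section Conjugates.
Variables (F : finFieldType) (K : closedFieldType) (iota : {rmorphism F -> K}).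
Variables (p e : nat) (charKp : p \in [pchar K]).
Hypothesis card_F : #|F| = (p ^ e)%N.
Let q := (p ^ e)%N.
Let sigma := Frobenius_twist (pnat_expn charKp e).
Variable h : {poly {poly F}}.
Hypothesis no_factor : ~ exists g, abs_irreducible_factor iota g h.

Let q_gt0 : (0 < q)%N.
Proof. by rewrite /q -card_F; apply/card_gt0P; exists 0. Qed.

Implicit Types u v w g : {poly {poly K}}.
Lemma Frobenius_twist_fixed u :
  (forall i j, u`_i`_j ^+ q = u`_i`_j) -> sigma u = u.
Proof.
by move=> u_fix; apply/polyP=> i; apply/polyP=> j; rewrite coef_Frobenius_twist u_fix.
Qed.

Let sigmaM u v : sigma (u * v) = sigma u * sigma v.
Proof. exact: rmorphM. Qed.

Let pow_poly_inj : injective (map_poly (power_map (pnat_expn charKp e))).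
Proof. exact: map_inj_poly (@fmorph_inj _ _ _) (rmorph0 _). Qed.

Let sigma_inj : injective sigma.
Proof. exact: map_inj_poly pow_poly_inj (rmorph0 _). Qed.

Lemma bidegree_sum_twist u : bidegree_sum (sigma u) = bidegree_sum u.
Proof.
rewrite /bidegree_sum /sigma /Frobenius_twist swapXY_map.
by rewrite !(size_map_inj_poly pow_poly_inj (rmorph0 _)).
Qed.

(** If g divides its conjugate then both agree up to a scalar l, as they have
    the same degrees.  Dividing g by one of its coefficients makes all of them
    fixed by Frobenius, which gives a factor of h over F. *)
Lemma factor_not_self_conjugate g :
    irreducible_elt g -> (exists u, embed_XY iota h = g * u) ->
  ~ exists w, sigma g = g * w.
Proof.
move=> [g0 g_nu g_fact] [u hE] [w gw].
have sg0 : sigma g != 0.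
  apply: contraNneq g0 => sg0; apply/eqP/sigma_inj.
  by rewrite sg0 /sigma /Frobenius_twist rmorph0.
have w0 : w != 0 by apply: contraNneq sg0 => w0; rewrite gw w0 mulr0.
have Uw : w \is a GRing.unit.
  apply: bidegree_sum0_unit => //; apply/eqP.
  rewrite -(eqn_add2l (bidegree_sum g)) -bidegree_sumM // -gw addn0.
  by rewrite bidegree_sum_twist.
have /unit_poly2P[l l0 wE] := Uw.
have g_coef i j : g`_i`_j ^+ q = l * g`_i`_j.
  rewrite -(coef_Frobenius_twist (pnat_expn charKp e)) -/sigma gw wE mulrC.
  by rewrite !coefCM.
have [i [j gij0]] : exists i j, g`_i`_j != 0.
  exists (size g).-1, (size (lead_coef g)).-1.
  by rewrite -[g`_ _]/(lead_coef g) -/(lead_coef (lead_coef g)) !lead_coef_eq0.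
(* This multiple of g has a coefficient equal to 1, so its conjugate is itself. *)
pose y := g`_i`_j; pose c : {poly {poly K}} := y^-1%:P%:P.
have Uc : c \is a GRing.unit by apply/unit_poly2P; exists y^-1; rewrite ?invr_eq0.
have c0 : c != 0 by apply: contraTneq Uc => ->; rewrite unitr0.
pose g1 := c * g.
have g1_fix k l' : g1`_k`_l' ^+ q = g1`_k`_l'.
  rewrite /g1 /c !coefCM exprMn exprVn !g_coef invfM mulrACA mulVf ?mul1r //.
have [g2 g2E] : exists g2 : {poly {poly F}}, g1 = embed_XY iota g2.
  by apply: embed_XY_descent => k l'; rewrite card_F g1_fix.
have hE1 : embed_XY iota h = g1 * (c^-1 * u).
  by rewrite hE /g1 [c * g]mulrC mulrA mulrK.
have u_fix : sigma (c^-1 * u) = c^-1 * u.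
  have g10 : g1 != 0 by rewrite mulf_neq0.
  apply: (mulfI g10); rewrite -{1}(Frobenius_twist_fixed g1_fix) -sigmaM -hE1.
  by apply: Frobenius_twist_fixed => i' j'; rewrite /q -card_F embed_XY_fixed.
have [u2 u2E] : exists u2 : {poly {poly F}}, c^-1 * u = embed_XY iota u2.
  apply: embed_XY_descent => k l'.
  by rewrite card_F -(coef_Frobenius_twist (pnat_expn charKp e)) -/sigma u_fix.
apply: no_factor; exists g2; split.
  rewrite -g2E; split.
  - by rewrite mulf_neq0.
  - by rewrite unitrMr.
  move=> v w' vw; have := g_fact (c^-1 * v) w'.
  rewrite -mulrA -vw mulKr // unitrMr ?unitrV //; exact.
exists u2; apply: (embed_XY_inj (iota := iota)).
by rewrite hE1 g2E u2E /embed_XY rmorphM.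
Qed.

(** The list s holds the coefficients of g and the coordinates of the common
    zeros of g and its conjugate.  If the n-th iterate of Frobenius acts on s as
    Frobenius itself, a point of g over GF(q^n) lies on both curves. *)
Lemma factor_points_listed g :
    irreducible_elt g -> (exists u, embed_XY iota h = g * u) ->
  exists s : seq K, forall n, {in s, forall x, x ^+ (q ^ n) = x ^+ q} ->
    forall a b, a ^+ (q ^ n) = a -> b ^+ (q ^ n) = b -> g.[b, a] = 0 ->
  a \in s /\ b \in s.
Proof.
move=> irr_g /(factor_not_self_conjugate irr_g) ndvd.
have [Z ZP] := finite_common_zeros irr_g ndvd.
pose coefs := flatten [seq polyseq r | r <- polyseq g].
exists (coefs ++ [seq z.1 | z <- Z] ++ [seq z.2 | z <- Z]) => n s_n a b aQ bQ gab.
have g_coef i j : g`_i`_j ^+ (q ^ n) = g`_i`_j ^+ q.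
  have pow0 : 0 ^+ (q ^ n) = 0 ^+ q :> K.
    by rewrite !expr0n !gtn_eqF // expn_gt0 q_gt0.
  have [lt_i|le_i] := ltnP i (size g); last first.
    by rewrite [g`_i]nth_default // coef0.
  have [lt_j|le_j] := ltnP j (size (g`_i)%R); last first.
    by rewrite [g`_i`_j]nth_default.
  apply: s_n; rewrite mem_cat; apply/orP; left; apply/flattenP.
  by exists (polyseq g`_i); rewrite ?mem_nth //; apply: map_f; apply: mem_nth.
have : (sigma g).[b, a] = 0.
  have -> : sigma g = Frobenius_twist (pnat_q charKp e n) g.
    apply/polyP=> i; apply/polyP=> j; by rewrite !coef_Frobenius_twist g_coef.
  rewrite -{1}aQ -{1}bQ horner_Frobenius_twist gab expr0n eqn0Ngt expn_gt0.
  by rewrite -/q q_gt0.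
move/(ZP _ _ gab) => Zba; rewrite !mem_cat.
by rewrite (map_f snd Zba) (map_f fst Zba) !orbT.
Qed.
End Conjugates.

(** * The equivalence *)

Theorem corollary1p7 (p q : nat) (p_prime : prime p)
    (q_power : exists2 e : nat, (0 < e)%N & q = (p ^ e)%N)
    (K : closedFieldType) (kappa : {rmorphism 'F_p -> K})
    (K_algebraic : integralRange kappa)
    (F : finFieldType) (card_F : #|F| = q) (iota : {rmorphism F -> K})
    (h : {poly {poly F}}) (h_neq0 : h != 0) :
  (~ exists g : {poly {poly F}}, abs_irreducible_factor iota g h)
  <->
  (forall N : nat, exists2 n : nat, (N < n)%N &
     exists2 L : {pred K}, finite_subfield (q ^ n)%N L &
       {subset zero_locus iota h L <= affine_plane [in codom iota]}).
Proof.
have [e e_gt0 qE] := q_power; rewrite {q q_power}qE in card_F *.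
have charKp := pchar_of_Fp p_prime kappa.
have in_F x : (x \in codom iota) = (x ^+ (p ^ e) == x).
  by rewrite codom_fixed card_F.
split=> [no_factor N | bad_n [g [irr_g [u hE]]]].
  have hK0 : embed_XY iota h != 0.
    by apply: contraNneq h_neq0 => hK0; apply/eqP/(embed_XY_inj (iota := iota));
       rewrite hK0 /embed_XY rmorph0.
  have [c [gs [Uc irr_gs hE]]] := irreducible_factorization hK0.
  have [s sP] : exists s : seq K, forall n,
      {in s, forall x, x ^+ ((p ^ e) ^ n) = x ^+ (p ^ e)} ->
    forall g a b, g \in gs -> a ^+ ((p ^ e) ^ n) = a -> b ^+ ((p ^ e) ^ n) = b ->
    g.[b, a] = 0 -> a \in s /\ b \in s.
    have factor_h g : g \in gs -> exists u, embed_XY iota h = g * u.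
      move=> g_gs; rewrite hE (big_rem g) //= mulrCA.
      by eexists; reflexivity.
    elim: (gs) irr_gs factor_h => [|g gs' IHgs] irr_gs' factor_h.
      by exists [::].
    have [|g' g'_gs|s' s'P] := IHgs.
    - by move=> g' g'_gs; apply: irr_gs'; rewrite inE g'_gs orbT.
    - by apply: factor_h; rewrite inE g'_gs orbT.
    have g_gs : g \in g :: gs' by rewrite mem_head.
    have [s1 s1P] := factor_points_listed charKp card_F no_factor
      (irr_gs' g g_gs) (factor_h g g_gs).
    exists (s1 ++ s') => n s_n g' a b; rewrite inE !mem_cat.
    case/orP=> [/eqP-> | g'_gs] aQ bQ gab.
      have [|-> ->] := s1P n _ a b aQ bQ gab => //.
      by move=> x x_s1; apply: s_n; rewrite mem_cat x_s1.
    have [|-> ->] := s'P n _ g' a b g'_gs aQ bQ gab; last by rewrite !orbT.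
    by move=> x x_s'; apply: s_n; rewrite mem_cat x_s' orbT.
  have [M M_gt0 MP] := common_Frobenius_period e p_prime K_algebraic s.
  (* As n = 1 modulo M, Frobenius^n acts on s as Frobenius. *)
  pose n := (M * N.+1).+1; exists n.
    exact: leq_trans (leq_pmull _ M_gt0) (leqnSn _).
  exists ([pred x : K | x ^+ ((p ^ e) ^ n) == x] : {pred K}).
    by rewrite -expnM; apply: finite_subfield_exists; rewrite ?muln_gt0 ?e_gt0.
  have s_n : {in s, forall x, x ^+ ((p ^ e) ^ n) = x ^+ (p ^ e)}.
    move=> x /MP xM; rewrite expnS mulnC exprM; congr (_ ^+ _).
    by rewrite expnM expr_fixed_iter.
  move=> [b a]; rewrite !inE /= => /andP[/andP[/eqP bQ /eqP aQ]].
  rewrite hE !hornerM mulf_eq0 => /orP[].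
    case/unit_poly2P: Uc => c0 c0_neq0 ->; rewrite !hornerC.
    by rewrite (negPf c0_neq0).
  rewrite !horner_prod prodf_seq_eq0 => /hasP[g g_gs /eqP gab].
  have [a_s b_s] := sP n s_n g a b g_gs aQ bQ gab.
  by rewrite !in_F -!s_n // aQ bQ !eqxx.
have g_fix i j : (embed_XY iota g)`_i`_j ^+ (p ^ e) = (embed_XY iota g)`_i`_j.
  by rewrite -card_F embed_XY_fixed.
have [n0 n0P] := irreducible_curve_points charKp e_gt0 irr_g g_fix.
have [n n0_n [L Ln subF]] := bad_n n0.
have [a [b [aQ bQ gab notF]]] := n0P n (ltnW n0_n).
have Q_gt1 : (1 < (p ^ e) ^ n)%N.
  rewrite -expnM -(expn0 p) ltn_exp2l ?prime_gt1 // muln_gt0 e_gt0.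
  exact: leq_ltn_trans n0_n.
have /subF : (b, a) \in zero_locus iota h L.
  rewrite !inE /= !(finite_subfieldE Q_gt1 Ln) !inE aQ bQ !eqxx /=.
  by rewrite hE /embed_XY rmorphM !hornerM gab mul0r.
by rewrite !inE /= !in_F andbC (negPf notF).
Qed.
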